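(* Let $(M,\mathcal F,g_\intercal)$ be a transversely time-oriented Lorentzian foliation. If $(M,\mathcal F,g_\intercal)$ admits a transverse temporal function, or equivalently, if there exists a bundle-like Lorentzian metric $g$ for $(M,\mathcal F)$ associated with $g_\intercal$ such that $(M,g)$ admits a basic temporal function, then $(M,\mathcal F,g_\intercal)$ is transversely stably causal.
   Context: $M$ is a connected smooth manifold of dimension $n\ge 3$. $\mathcal F$ is a regular foliation of codimension $q\geq 2$: a partition of $M$ into connected immersed submanifolds (leaves), locally given by the fibers of a submersion. $T\mathcal F\subset TM$ is the (vertical) distribution tangent to the leaves; vectors in $T\mathcal F$, and vector fields with values in it, are called vertical. A function is basic if it is constant on the leaves. A (local) vector field $X$ is projectable if $[V,X]$ is vertical for every vertical $V$. A transverse Lorentzian metric on $(M,\mathcal F)$ is a smooth symmetric $(0,2)$-tensor field $g_\intercal$ on $M$ with $\mathcal L_Vg_\intercal=0$ for all vertical $V$, such that at each $x$ the bilinear form $g_\intercal(x)$ has index $1$ and its kernel is exactly $T_x\mathcal F$. $\mathcal{TL}(M,\mathcal F)$ is the set of these. The triple $(M,\mathcal F,g_\intercal)$ is then called a Lorentzian foliation. A nonvertical vector $v$ is transversely timelike if $g_\intercal(v,v)<0$ and transversely causal if $g_\intercal(v,v)\le 0$. The set of transversely causal vectors at $x$ has two connected components (causal wedges); a transverse time orientation is a continuous choice of one of them (the future causal wedge) at each point; vectors in it are future-directed. A future-directed transversely causal curve is a piecewise smooth curve whose tangent vectors lie in the future causal wedges. For leaves $L,L'$, write $L<_{M/\mathcal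 F}L'$ if there is a future-directed transversely causal curve from a point of $L$ to a point of $L'$. $(M,\mathcal F,g_\intercal)$ is transversely causal if $L\nless_{M/\mathcal F}L$ for every leaf $L$. For $g_\intercal,g'_\intercal\in\mathcal{TL}(M,\mathcal F)$, write $g_\intercal<g'_\intercal$ if for every $v\in TM\setminus T\mathcal F$, $g_\intercal(v,v)\le0\Rightarrow g'_\intercal(v,v)<0$; in that case $g'_\intercal$ is time-oriented so that its future wedges contain those of $g_\intercal$. $(M,\mathcal F,g_\intercal)$ is transversely stably causal if there is $g'_\intercal\in\mathcal{TL}(M,\mathcal F)$ with $g_\intercal<g'_\intercal$ and $(M,\mathcal F,g'_\intercal)$ transversely causal. A Lorentzian metric $g$ on $M$ is bundle-like if $TM=T\mathcal F\oplus T\mathcal F^{\perp_g}$ and, on every open set, $g(X,Y)$ is basic for all projectable $X,Y$ with values in $T\mathcal F^{\perp_g}$. It is associated with $g_\intercal$ if $g(X^\perp,Y^\perp)=g_\intercal(X,Y)$ for all vector fields $X,Y$, where $X^\perp$ is the component in $T\mathcal F^{\perp_g}$. Every $g$-causal vector is then transversely causal, and $(M,g)$ is time-oriented by declaring future-directed those $g$-causal vectors lying in the future causal wedges. A temporal function on $(M,g)$ is a smooth function whose $g$-gradient is past-directed timelike everywhere. A transverse temporal function on $(M,\mathcal F,g_\intercal)$ is a smooth $f:M\to\mathbb R$ with $df(v)>0$ for every future-directed transversely causal $v\in TM$. *)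

(* Defs.v *)
From mathcomp Require Import all_boot all_order all_algebra.
From mathcomp Require Import all_classical all_reals all_analysis.

Set Implicit Arguments.
Unset Strict Implicit.
Unset Printing Implicit Defensive.

Import Order.TTheory GRing.Theory Num.Theory.
Import numFieldNormedType.Exports.

Local Open Scope classical_set_scope.
Local Open Scope ring_scope.

(* C^infinity on an open set [U]: every iterated directional derivative of [f]
   is (Frechet) differentiable at every point of [U].  Only the germs of [f]
   at the points of [U] matter. *)
Definition smooth_on (R : realType) (V W : normedModType R)
    (U : set V) (f : V -> W) : Prop :=
  forall (vs : seq V) (x : V), U x ->
    differentiable (foldr (fun v h => 'D_v h) f vs) x.

(* [fwd] and [bwd] are total, but only their values on [dom] and on
   [fwd @` dom] are meaningful. *)
Record chart (R : realType) (n : nat) (M : topologicalType) := Chart {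
  dom : set M;
  fwd : M -> 'rV[R]_n;
  bwd : 'rV[R]_n -> M;
  dom_open : open dom;
  img_open : open (fwd @` dom);
  fwdK : forall x, dom x -> bwd (fwd x) = x;
  fwd_continuous : forall x, dom x -> {for x, continuous fwd};
  bwd_continuous : forall x, dom x -> {for fwd x, continuous bwd} }.

(* The atlas need not be maximal.  [chart_at x] is a distinguished chart
   around [x]; it serves to represent tangent vectors (see below). *)
Record manifold (R : realType) (n : nat) := Manifold {
  carrier :> topologicalType;
  manifold_hausdorff : hausdorff_space carrier;
  manifold_second_countable : @second_countable carrier;
  atlas : set (chart R n carrier);
  chart_at : carrier -> chart R n carrier;
  atlas_chart_at : forall x, atlas (chart_at x);
  dom_chart_at : forall x, dom (chart_at x) x;
  atlas_compatible : forall c d, atlas c -> atlas d ->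
    smooth_on (fwd c @` (dom c `&` dom d)) (fwd d \o bwd c) }.

(* The tangent space T_x M is 'rV[R]_n: a tangent vector at [x] is given by its
   coordinates in the distinguished chart [chart_at x].  Thus a vector field is
   a map M -> 'rV[R]_n, and a field of bilinear forms is a map M -> 'M[R]_n. *)

(* Coordinates in the chart [c] of the tangent vector [v] at [x]. *)
Definition to_chart R n (M : manifold R n) (c : chart R n M) (x : M)
    (v : 'rV[R]_n) : 'rV[R]_n :=
  'D_v (fwd c \o bwd (chart_at x)) (fwd (chart_at x) x).

(* The tangent vector at [x] whose coordinates in the chart [c] are [u]. *)
Definition of_chart R n (M : manifold R n) (c : chart R n M) (x : M)
    (u : 'rV[R]_n) : 'rV[R]_n :=
  'D_u (fwd (chart_at x) \o bwd c) (fwd c x).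

Definition smooth_fun R n (M : manifold R n) (W : normedModType R)
    (U : set M) (f : M -> W) : Prop :=
  forall c, atlas c -> smooth_on (fwd c @` (U `&` dom c)) (f \o bwd c).

(* df_x(v), for [f] with values in a normed space *)
Definition dfun R n (M : manifold R n) (W : normedModType R)
    (f : M -> W) (x : M) (v : 'rV[R]_n) : W :=
  'D_v (f \o bwd (chart_at x)) (fwd (chart_at x) x).

Definition smooth_map R p n (N : manifold R p) (M : manifold R n)
    (i : N -> M) : Prop :=
  continuous i /\
  forall c d, atlas c -> atlas d ->
    smooth_on (fwd c @` (dom c `&` i @^-1` dom d)) (fwd d \o i \o bwd c).

(* di_z : T_z N -> T_{i z} M *)
Definition tangent_map R p n (N : manifold R p) (M : manifold R n)
    (i : N -> M) (z : N) (w : 'rV[R]_p) : 'rV[R]_n :=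
  'D_w (fwd (chart_at (i z)) \o i \o bwd (chart_at z)) (fwd (chart_at z) z).

(* The local representative of the vector field [X] in the chart [c]. *)
Definition vrep R n (M : manifold R n) (c : chart R n M)
    (X : M -> 'rV[R]_n) (y : 'rV[R]_n) : 'rV[R]_n :=
  to_chart c (bwd c y) (X (bwd c y)).

Definition smooth_vfield R n (M : manifold R n) (U : set M)
    (X : M -> 'rV[R]_n) : Prop :=
  forall c, atlas c -> smooth_on (fwd c @` (U `&` dom c)) (vrep c X).

Definition continuous_vfield R n (M : manifold R n) (U : set M)
    (X : M -> 'rV[R]_n) : Prop :=
  forall c, atlas c ->
    forall y, (fwd c @` (U `&` dom c)) y -> {for y, continuous (vrep c X)}.

(* [V, X] at [x], computed in the distinguished chart at [x] *)
Definition bracket R n (M : manifold R n) (V X : M -> 'rV[R]_n) (x : M) :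
    'rV[R]_n :=
  let c := chart_at x in
  'D_(V x) (vrep c X) (fwd c x) - 'D_(X x) (vrep c V) (fwd c x).

Definition bil (R : realType) n (G : 'M[R]_n) (u v : 'rV[R]_n) : R :=
  (u *m G *m v^T) 0 0.

Definition bil_kernel (R : realType) n (G : 'M[R]_n) : set 'rV[R]_n :=
  [set v | forall w, bil G v w = 0].

(* Subspaces of 'rV[R]_n are represented by the row spaces of matrices. *)
Definition negative_definite_on (R : realType) n (G W : 'M[R]_n) : Prop :=
  forall v : 'rV[R]_n, (v <= W)%MS -> v != 0 -> bil G v v < 0.

(* the maximal dimension of a subspace on which [G] is negative definite *)
Definition has_index (R : realType) n (G : 'M[R]_n) (k : nat) : Prop :=
  (exists2 W : 'M[R]_n, negative_definite_on G W & \rank W = k) /\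
  (forall W : 'M[R]_n, negative_definite_on G W -> (\rank W <= k)%N).

(* smooth (0,2)-tensor field: smooth components in every chart *)
Definition smooth_tensor R n (M : manifold R n) (g : M -> 'M[R]_n) : Prop :=
  forall c, atlas c -> forall u v : 'rV[R]_n,
    smooth_on (fwd c @` dom c)
      (fun y => bil (g (bwd c y)) (of_chart c (bwd c y) u)
                                  (of_chart c (bwd c y) v)).

(* (L_V g)(X, Y) = V (g(X, Y)) - g([V, X], Y) - g(X, [V, Y]) *)
Definition lie_derivative R n (M : manifold R n) (V : M -> 'rV[R]_n)
    (g : M -> 'M[R]_n) (X Y : M -> 'rV[R]_n) (x : M) : R :=
  dfun (fun y => bil (g y) (X y) (Y y)) x (V x)
  - bil (g x) (bracket V X x) (Y x) - bil (g x) (X x) (bracket V Y x).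

Definition lorentzian_metric R n (M : manifold R n) (g : M -> 'M[R]_n) : Prop :=
  smooth_tensor g /\
  forall x, [/\ (g x)^T = g x, bil_kernel (g x) = [set 0] & has_index (g x) 1].

(* A foliation of codimension [q]: a partition of [M] into connected injectively
   immersed submanifolds [incl l : leaf l -> M] of dimension n - q, which are
   locally the fibers of a submersion.  The leaves through [U] are cut by [U]
   into connected pieces (for the leaf topology), and these are the fibers. *)
Record foliation R n (M : manifold R n) (q : nat) := Foliation {
  leaf_index : Type;
  leaf : leaf_index -> manifold R (n - q);
  incl : forall l, leaf l -> M;
  leaf_nonempty : forall l, [set: leaf l] !=set0;
  leaf_connected : forall l, connected [set: leaf l];
  incl_smooth : forall l, smooth_map (@incl l);
  incl_injective : forall l, injective (@incl l);
  incl_immersion : forall l z, injective (tangent_map (@incl l) z);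
  leaf_cover : forall x, exists l, exists z, @incl l z = x;
  leaf_disjoint : forall l l' z z', @incl l z = @incl l' z' -> l = l';
  local_submersion : forall x, exists (U : set M) (s : M -> 'rV[R]_q),
    [/\ open U, U x, smooth_fun U s,
        forall y, U y -> forall w, exists v, dfun s y v = w &
        forall l (z : leaf l), U (@incl l z) ->
          @incl l @` connected_component (@incl l @^-1` U) z =
          U `&` [set y | s y = s (@incl l z)]] }.

Section Foliation.
Context (R : realType) (n q : nat) (M : manifold R n) (F : foliation M q).

(* T_x F *)
Definition vertical (x : M) : set 'rV[R]_n :=
  [set v | exists (l : leaf_index F) (z : leaf l) w,
         incl z = x /\ tangent_map (incl (l:=l)) z w = v].

Definition vertical_vfield (U : set M) (V : M -> 'rV[R]_n) : Prop :=
  smooth_vfield U V /\ forall x, U x -> vertical x (V x).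

(* The leaves of the foliation induced on the open set [U] are the connected
   components, for the leaf topology, of the intersections of the leaves
   with [U]. *)
Definition basic_on (U : set M) (f : M -> R) : Prop :=
  forall (l : leaf_index F) (z z' : leaf l), U (incl z) ->
    connected_component (incl (l:=l) @^-1` U) z z' ->
    f (incl z') = f (incl z).

(* The vertical fields [V] may be defined on open subsets of [U] only. *)
Definition projectable (U : set M) (X : M -> 'rV[R]_n) : Prop :=
  smooth_vfield U X /\
  forall (W : set M) (V : M -> 'rV[R]_n), open W -> W `<=` U ->
    vertical_vfield W V -> forall x, W x -> vertical x (bracket V X x).

(* membership in TL(M, F) *)
Definition transverse_lorentzian (gT : M -> 'M[R]_n) : Prop :=
  [/\ smooth_tensor gT,
      forall x, [/\ (gT x)^T = gT x, bil_kernel (gT x) = vertical x &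
                    has_index (gT x) 1] &
      forall (U : set M) (V X Y : M -> 'rV[R]_n), open U ->
        vertical_vfield U V -> smooth_vfield U X -> smooth_vfield U Y ->
        forall x, U x -> lie_derivative V gT X Y x = 0].

Definition transversely_causal_vec (gT : M -> 'M[R]_n) (x : M) : set 'rV[R]_n :=
  [set v | ~ vertical x v /\ bil (gT x) v v <= 0].

(* [fut x] is the future causal wedge at [x]; continuity of the choice means
   that the wedges locally contain a continuous vector field. *)
Definition transverse_time_orientation (gT : M -> 'M[R]_n)
    (fut : M -> set 'rV[R]_n) : Prop :=
  (forall x, exists2 v, transversely_causal_vec gT x v &
     fut x = connected_component (transversely_causal_vec gT x) v) /\
  (forall x, exists (U : set M) (X : M -> 'rV[R]_n),
     [/\ open U, U x, continuous_vfield U X & forall y, U y -> fut y (X y)]).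

Definition smooth_curve (J : set R) (gam : R -> M) : Prop :=
  (forall t, J t -> {for t, continuous gam}) /\
  forall c, atlas c -> smooth_on (J `&` gam @^-1` dom c) (fwd c \o gam).

Definition velocity (gam : R -> M) (t : R) : 'rV[R]_n :=
  derive1 (fwd (chart_at (gam t)) \o gam) t.

(* Piecewise smooth curve on [a, b] with all velocities in the future wedges:
   on each of the subintervals cut by a = t_0 < ... < t_k = b, the curve is the
   restriction of a smooth curve [del] defined on an open neighbourhood. At the
   breakpoints both one-sided velocities are constrained. *)
Definition future_causal_curve (fut : M -> set 'rV[R]_n) (a b : R)
    (gam : R -> M) : Prop :=
  a < b /\
  exists ts : seq R,
    [/\ path <%R a ts, last a ts = b &
        forall i, (i < size ts)%N ->
          let I := [set t : R | nth 0 (a :: ts) i <= t <= nth 0 ts i] in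
          exists (J : set R) (del : R -> M),
            [/\ open J, I `<=` J, smooth_curve J del &
                forall t, I t -> gam t = del t /\ fut (del t) (velocity del t)]].

(* L <_{M/F} L' *)
Definition leaf_lt (fut : M -> set 'rV[R]_n) (l l' : leaf_index F) : Prop :=
  exists (a b : R) (gam : R -> M),
    [/\ future_causal_curve fut a b gam,
        exists z : leaf l, incl z = gam a &
        exists z : leaf l', incl z = gam b].

Definition transversely_causal (fut : M -> set 'rV[R]_n) : Prop :=
  forall l, ~ leaf_lt fut l l.

Definition wider_cones (gT gT' : M -> 'M[R]_n) : Prop :=
  forall x v, ~ vertical x v -> bil (gT x) v v <= 0 -> bil (gT' x) v v < 0.

Definition transversely_stably_causal (gT : M -> 'M[R]_n)
    (fut : M -> set 'rV[R]_n) : Prop :=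
  exists (gT' : M -> 'M[R]_n) (fut' : M -> set 'rV[R]_n),
    [/\ transverse_lorentzian gT', wider_cones gT gT',
        transverse_time_orientation gT' fut',
        forall x, fut x `<=` fut' x & transversely_causal fut'].

Definition transverse_temporal (fut : M -> set 'rV[R]_n) (f : M -> R) : Prop :=
  smooth_fun setT f /\ forall x v, fut x v -> 0 < dfun f x v.

(* the g-orthogonal complement of T_x F *)
Definition vertical_perp (g : M -> 'M[R]_n) (x : M) : set 'rV[R]_n :=
  [set v | forall w, vertical x w -> bil (g x) v w = 0].

Definition bundle_like (g : M -> 'M[R]_n) : Prop :=
  [/\ lorentzian_metric g,
      forall x v, exists u w, [/\ vertical x u, vertical_perp g x w & v = u + w],
      forall x, vertical x `&` vertical_perp g x `<=` [set 0] &
      forall (U : set M) (X Y : M -> 'rV[R]_n), open U ->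
        projectable U X -> projectable U Y ->
        (forall x, U x -> vertical_perp g x (X x)) ->
        (forall x, U x -> vertical_perp g x (Y x)) ->
        basic_on U (fun x => bil (g x) (X x) (Y x))].

(* [w] is the component of [v] in the g-orthogonal complement of T_x F *)
Definition perp_component (g : M -> 'M[R]_n) (x : M) (v w : 'rV[R]_n) : Prop :=
  vertical_perp g x w /\ vertical x (v - w).

(* g(X^perp, Y^perp) = gT(X, Y); both sides are tensorial *)
Definition associated (g gT : M -> 'M[R]_n) : Prop :=
  forall x v v' w w', perp_component g x v v' -> perp_component g x w w' ->
    bil (g x) v' w' = bil (gT x) v w.

(* Temporal function on (M, g), for [g] time-oriented by the wedges [fut]: the
   g-gradient [v] of [f] is timelike and [- v] is future-directed. *)
Definition temporal (g : M -> 'M[R]_n) (fut : M -> set 'rV[R]_n)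
    (f : M -> R) : Prop :=
  smooth_fun setT f /\
  forall x, exists v : 'rV[R]_n,
    [/\ forall w, bil (g x) v w = dfun f x w, bil (g x) v v < 0 & fut x (- v)].

End Foliation.

(* Main.v *)
(* A transverse temporal function [f] has [df = 0] on vertical vectors, because
   adding a multiple of a vertical vector to a future vector gives a future
   vector; hence [f] is basic.  On the kernel of [df] the form [gT] is positive
   semidefinite with kernel T F, so [gT - df (x) df] still has index 1 and kernel
   T F, has wider cones, and its causal vectors are still split by the sign of
   [df].  Its Lie derivative along vertical fields vanishes as [f] is basic, and
   [f] strictly increases along its future causal curves, which therefore
   cannot return to a leaf: this gives transverse stable causality.

   For the equivalence, a Riemannian metric [h] on M (glued from bump functions)
   gives the [h]-orthogonal projection [P] onto T F, and
   [gT + h(P -, P -)] is a bundle-like metric associated with [gT], for which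
   the gradient of [f] is horizontal and past timelike.  Conversely, for a basic
   temporal function the gradient [v] is horizontal, so [df(w) = gT(v, w)], and
   the sign follows from the geometry of the Lorentzian cone of [gT]. *)

Require Import Defs.
From mathcomp Require Import all_boot all_order all_algebra.
From mathcomp Require Import all_classical all_reals all_analysis.
From mathcomp Require Import ring lra zify.

Set Implicit Arguments.
Unset Strict Implicit.
Unset Printing Implicit Defensive.

Import Order.TTheory GRing.Theory Num.Theory.
Import numFieldNormedType.Exports.

Local Open Scope classical_set_scope.
Local Open Scope ring_scope.

(** * Smooth functions on normed spaces *)

(** Two obstacles shape the proof. First, a future wedge is given only as a connected component. It
    is made algebraic through a linear form that separates the two wedges ([cone_form]): the
    differential of a transverse temporal function is one at each point, and so is the dual of a
    timelike vector. Such a form also bounds the index of each modified metric, because every plane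
    meets its kernel. Second, vectors and tensors at [x] are written in [chart_at x], which may
    change abruptly with [x], so smoothness is read from representatives in one fixed chart. The
    projection onto the vertical bundle is moreover built from a basis chosen point by point; it is
    therefore characterised uniquely and recomputed near each point from a smooth frame, available
    because the rank of [gT] is constant. For the Riemannian metric, positivity survives sums with
    nonnegative weights, so the weights are left unnormalised and only their local finiteness has to
    be arranged. *)

Lemma near_eq_differentiable (R : realType) (V W : normedModType R)
    (f g : V -> W) x :
  (\near x, f x = g x) -> differentiable f x -> differentiable g x.
Proof.
move=> fg df.
suff h0 : differentiable (g - f) x.
  by rewrite -(subrK f g); apply: differentiableD.
have e0 : (g - f) \o shift x = cst ((g - f) x) + (\0 : {linear V -> W}) +o_ 0 id.
  apply/eqaddoP => _/posnumP[e].
  rewrite /= (_ : (g - f) x = 0); last first.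
    rewrite !fctE (nbhs_singleton fg); exact: subrr.
  have : \forall y \near (0 : V), f (y + x) = g (y + x).
    rewrite (near_shift x 0); near=> z; rewrite /= sub0r subrK; near: z; exact: fg.
  apply: filterS => y e1.
  rewrite -[X in `|X|]/(g (y + x) - f (y + x) - (0 + 0)) e1 subrr addr0 subr0 normr0.
  exact: mulr_ge0.
have c0 : continuous (\0 : {linear V -> W}) by move=> y; exact: cvg_cst.
apply/diff_locallyP.
have h := diff_unique c0 e0; split; first by rewrite h.
by rewrite h e0.
Unshelve. all: by end_near. Qed.

Section Ck.
Context (R : realType).

(* The derivatives of order at most [k] are differentiable near [x], which is
   slightly more than class C^k.  For open [U], [smooth_on U f] means
   [Ck k f x] for all [k] and all [x] in [U]; the neighbourhoods may depend on
   [k]. *)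
Fixpoint Ck (V W : normedModType R) k (f : V -> W) (x : V) : Prop :=
  (\forall y \near x, differentiable f y) /\
  (if k is k'.+1 then forall v, Ck k' ('D_v f) x else True).

Lemma Ck_diff (V W : normedModType R) k (f : V -> W) x :
  Ck k f x -> \forall y \near x, differentiable f y.
Proof. by case: k => [|k] []. Qed.

Lemma Ck_near (V W : normedModType R) k (f g : V -> W) x :
  (\forall y \near x, f y = g y) -> Ck k f x -> Ck k g x.
Proof.
have d (h1 h2 : V -> W) : (\forall y \near x, h1 y = h2 y) ->
   (\forall y \near x, differentiable h1 y) ->
   \forall y \near x, differentiable h2 y.
  move=> /near_join e dd; near=> y.
  by apply: (@near_eq_differentiable _ _ _ h1); near: y.
elim: k f g => [|k IH] f g e [] /= df Df; split; try exact: d df.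
  by [].
move=> v; apply: IH (Df v); move/near_join: e => e; near=> y.
by apply: near_eq_derive; near: y.
Unshelve. all: by end_near. Qed.

Lemma Ck_le (V W : normedModType R) k (f : V -> W) x : Ck k.+1 f x -> Ck k f x.
Proof.
elim: k f => [|k IH] f [df Df]; first by [].
by split=> // v; apply: IH.
Qed.

Lemma Ck_cst (V W : normedModType R) k (a : W) (x : V) : Ck k (fun=> a) x.
Proof.
elim: k a => [|k IH] a; split=> //; try by near=> y; exact: differentiable_cst.
move=> v; rewrite (_ : 'D_v _ = fun=> 0) //.
by apply/funext => y; exact: derive_cst.
Unshelve. all: by end_near. Qed.

Lemma CkD (V W : normedModType R) k (f g : V -> W) x :
  Ck k f x -> Ck k g x -> Ck k (fun y => f y + g y) x.
Proof.
elim: k f g => [|k IH] f g [df Df] [dg Dg]; split => //;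
  try by near=> y; apply: differentiableD; near: y.
move=> v; apply: (@Ck_near _ _ _ (fun y => 'D_v f y + 'D_v g y));
  last exact: IH (Df v) (Dg v).
near=> y; rewrite -[RHS]/('D_v (f + g) y) deriveD //;
  by apply: diff_derivable; near: y.
Unshelve. all: by end_near. Qed.

Lemma CkZ (V W : normedModType R) k (a : R) (f : V -> W) x :
  Ck k f x -> Ck k (fun y => a *: f y) x.
Proof.
elim: k f => [|k IH] f [df Df]; split => //;
  try by near=> y; apply: differentiableZ; near: y.
move=> v; apply: (@Ck_near _ _ _ (fun y => a *: 'D_v f y));
  last exact: IH (Df v).
near=> y; rewrite -[RHS]/('D_v (a *: f) y) deriveZ //.
by apply: diff_derivable; near: y.
Unshelve. all: by end_near. Qed.

Lemma CkM (V : normedModType R) k (f g : V -> R) x :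
  Ck k f x -> Ck k g x -> Ck k (fun y => f y * g y) x.
Proof.
elim: k f g => [|k IH] f g hf hg; have df := Ck_diff hf; have dg := Ck_diff hg.
  by split=> //; near=> y; apply: differentiableM; near: y.
split; first by near=> y; apply: differentiableM; near: y.
move=> v; apply: (@Ck_near _ _ _ (fun y => f y * 'D_v g y + g y * 'D_v f y)).
  near=> y; rewrite -[RHS]/('D_v (f * g) y) deriveM //;
    by apply: diff_derivable; near: y.
by apply: CkD; apply: IH; try exact: Ck_le;
  [case: hg => _ /(_ v)|case: hf => _ /(_ v)].
Unshelve. all: by end_near. Qed.

Lemma Ck_sum (V W : normedModType R) k (I : Type) (r : seq I) (P : pred I)
    (f : I -> V -> W) x :
  (forall i, P i -> Ck k (f i) x) -> Ck k (fun y => \sum_(i <- r | P i) f i y) x.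
Proof.
move=> hf; elim: r => [|i r IH].
  by under eq_fun do rewrite big_nil; exact: Ck_cst.
under eq_fun do rewrite big_cons.
by case Pi: (P i) => //; apply: CkD => //; exact: hf.
Qed.

Lemma Ck_prod (V : normedModType R) k (I : Type) (r : seq I) (P : pred I)
    (f : I -> V -> R) x :
  (forall i, P i -> Ck k (f i) x) -> Ck k (fun y => \prod_(i <- r | P i) f i y) x.
Proof.
move=> hf; elim: r => [|i r IH].
  by under eq_fun do rewrite big_nil; exact: Ck_cst.
under eq_fun do rewrite big_cons.
by case Pi: (P i) => //; apply: CkM => //; exact: hf.
Qed.

Lemma CkV (V : normedModType R) k (f : V -> R) x :
  f x != 0 -> Ck k f x -> Ck k (fun y => (f y)^-1) x.
Proof.
move=> fx0 hf.
have ne : \forall y \near x, f y != 0.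
  apply: cvgr_neq0 fx0; apply: differentiable_continuous.
  exact: nbhs_singleton (Ck_diff hf).
elim: k hf => [|k IH] hf; have df := Ck_diff hf.
- by split=> //; near=> y; apply: differentiableV; near: y.
- split; first by near=> y; apply: differentiableV; near: y.
  move=> v.
  apply: (@Ck_near _ _ _ (fun y => (- 1) *: ((f y)^-1 * (f y)^-1 * 'D_v f y))).
    near=> y; rewrite -[RHS]/('D_v (fun y => (f y)^-1) y) deriveV //.
    - by rewrite scaleN1r /GRing.scale /= expr2 invfM mulNr.
    - by near: y.
    - by apply: diff_derivable; near: y.
  apply: CkZ; apply: CkM; last by case: hf => _ /(_ v).
  by apply: CkM; apply: IH => //; exact: Ck_le.
Unshelve. all: by end_near. Qed.

Lemma differentiable_rowP (V : normedModType R) n (g : V -> 'rV[R]_n) x :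
  (forall i, differentiable (fun y => g y 0 i) x) -> differentiable g x.
Proof.
move=> dg; rewrite (_ : g = \sum_i (fun y => g y 0 i *: delta_mx 0 i)); last first.
  by apply/funext => y; rewrite {1}[g y]row_sum_delta fct_sumE.
apply: differentiable_sum => i; exact: differentiableZl.
Qed.

Lemma differentiable_coordE (V : normedModType R) n (g : V -> 'rV[R]_n) x i :
  differentiable g x -> differentiable (fun y => g y 0 i) x.
Proof.
by move=> dg; apply: (@differentiable_comp _ _ _ _ g (fun N => N 0 i)) => //;
  exact: differentiable_coord.
Qed.

Lemma derive_coordE (V : normedModType R) n (g : V -> 'rV[R]_n) x v i :
  differentiable g x -> 'D_v g x 0 i = 'D_v (fun y => g y 0 i) x.
Proof. by move=> dg; rewrite derive_mx ?mxE //; exact: diff_derivable. Qed.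

Lemma Ck_rowP (V : normedModType R) n k (g : V -> 'rV[R]_n) x :
  (forall i, Ck k (fun y => g y 0 i) x) <-> Ck k g x.
Proof.
split.
  elim: k g => [|k IH] g hg.
    split=> //; have : forall i, \forall y \near x, differentiable (fun y => g y 0 i) y.
      by move=> i; case: (hg i).
    by move=> /filter_forall; apply: filterS => y; exact: differentiable_rowP.
  have dg : \forall y \near x, differentiable g y.
    have : forall i, \forall y \near x, differentiable (fun y => g y 0 i) y.
      by move=> i; case: (hg i).
    by move=> /filter_forall; apply: filterS => y; exact: differentiable_rowP.
  split=> // v; apply: IH => i; case: (hg i) => _ /(_ v); apply: Ck_near.
  by near=> y; rewrite derive_coordE //; near: y.
elim: k g => [|k IH] g [dg Dg] i; split=> //;
  try by near=> y; apply: differentiable_coordE; near: y.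
move=> v; apply: Ck_near (IH _ (Dg v) i).
by near=> y; rewrite derive_coordE //; near: y.
Unshelve. all: by end_near. Qed.

Lemma derive_comp (U V W : normedModType R) (g : U -> V) (F : V -> W) x v :
  differentiable g x -> differentiable F (g x) ->
  'D_v (F \o g) x = 'D_('D_v g x) F (g x).
Proof.
move=> dg dF; rewrite (deriveE _ dF) (deriveE _ dg) deriveE.
  by rewrite diff_comp.
exact: differentiable_comp.
Qed.

Lemma derive_lin (V W : normedModType R) (F : V -> W) x a u v :
  differentiable F x -> 'D_(a *: u + v) F x = a *: 'D_u F x + 'D_v F x.
Proof. by move=> dF; rewrite !(deriveE _ dF) linearP. Qed.

Lemma derive_rowE (W : normedModType R) n (F : 'rV[R]_n -> W) x v :
  differentiable F x -> 'D_v F x = \sum_i v 0 i *: 'D_(delta_mx 0 i) F x.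
Proof.
move=> dF; rewrite deriveE // {1}[v]row_sum_delta linear_sum.
by apply: eq_bigr => i _; rewrite linearZ deriveE.
Qed.

(** The direction ['D_v g y] varies with [y]. Expanding it in the basis leaves derivatives of [F] in
    fixed directions, composed with [g], to which the induction hypothesis applies. *)
Lemma Ck_comp (U : normedModType R) n k (g : U -> 'rV[R]_n)
    (F : 'rV[R]_n -> R) x : Ck k g x -> Ck k F (g x) -> Ck k (F \o g) x.
Proof.
have dd (G : 'rV[R]_n -> R) : (\forall y \near x, differentiable g y) ->
    (\forall y \near g x, differentiable G y) ->
    \forall y \near x, differentiable g y /\ differentiable G (g y).
  move=> dg dG; have /(_ _ dG) dG' : {for x, continuous g}.
    by apply: differentiable_continuous; exact: nbhs_singleton dg.
  by near=> y; split; near: y.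
elim: k F => [|k IH] F hg hF; have := dd _ (Ck_diff hg) (Ck_diff hF) => dgF.
  by split=> //; apply: filterS dgF => y [? ?]; exact: differentiable_comp.
split; first by apply: filterS dgF => y [? ?]; exact: differentiable_comp.
move=> v; apply: (@Ck_near _ _ _
   (fun y => \sum_i 'D_v g y 0 i * ('D_(delta_mx 0 i) F \o g) y)).
  apply: filterS dgF => y [dg dF].
  by rewrite [RHS](derive_comp _ dg dF) (derive_rowE _ dF).
apply: Ck_sum => i _; apply: CkM.
  by move: i; apply/Ck_rowP; case: hg => _ /(_ v).
by apply: IH; [exact: Ck_le|case: hF => _ /(_ (delta_mx 0 i))].
Unshelve. all: by end_near. Qed.

Lemma Ck_comp1 (U : normedModType R) k (g : U -> R) (F : R -> R) x :
  Ck k g x -> Ck k F (g x) -> Ck k (F \o g) x.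
Proof.
have dd (G : R -> R) : (\forall y \near x, differentiable g y) ->
    (\forall y \near g x, differentiable G y) ->
    \forall y \near x, differentiable g y /\ differentiable G (g y).
  move=> dg dG; have /(_ _ dG) dG' : {for x, continuous g}.
    by apply: differentiable_continuous; exact: nbhs_singleton dg.
  by near=> y; split; near: y.
elim: k F => [|k IH] F hg hF; have := dd _ (Ck_diff hg) (Ck_diff hF) => dgF.
  by split=> //; apply: filterS dgF => y [? ?]; exact: differentiable_comp.
split; first by apply: filterS dgF => y [? ?]; exact: differentiable_comp.
move=> v; apply: (@Ck_near _ _ _ (fun y => 'D_v g y * ('D_1 F \o g) y)).
  apply: filterS dgF => y [dg dF].
  rewrite [RHS](derive_comp _ dg dF) (deriveE _ dF) /= (deriveE _ dF).
  by rewrite -[LHS]/('D_v g y *: 'd F (g y) 1) -linearZ /= [_ *: _]mulr1.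
apply: CkM; first by case: hg => _ /(_ v).
by apply: IH; [exact: Ck_le|case: hF => _ /(_ 1)].
Unshelve. all: by end_near. Qed.

Lemma Ck_lin (V W : normedModType R) k (f : {linear V -> W}) x :
  continuous f -> Ck k f x.
Proof.
move=> cf; case: k => [|k]; split=> //;
  try by near=> y; exact: linear_differentiable.
move=> v; rewrite (_ : 'D_v f = fun=> f v); first exact: Ck_cst.
apply/funext => y; rewrite deriveE; last exact: linear_differentiable.
by rewrite diff_lin.
Unshelve. all: by end_near. Qed.

Lemma Ck_id (V : normedModType R) k (x : V) : Ck k (fun y => y) x.
Proof.
by apply: (@Ck_lin _ _ _ (@idfun V : {linear V -> V})) => y; exact: cvg_id.
Qed.

Lemma smooth_onP (V W : normedModType R) (U : set V) (f : V -> W) : open U ->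
  smooth_on U f <-> forall x, U x -> forall k, Ck k f x.
Proof.
move=> oU; split.
  move=> sf x Ux k; elim: k f sf => [|k IH] f sf.
    split=> //; apply: (filterS (sf [::])); exact: open_nbhs_nbhs.
  split; first by apply: (filterS (sf [::])); exact: open_nbhs_nbhs.
  move=> v; apply: IH => vs y Uy.
  (* [foldr] applies the last direction of the list first, so a derivative taken before the others
     is appended at the end. *)
  by have := sf (rcons vs v) _ Uy; rewrite -cats1 foldr_cat.
move=> hf vs x Ux; have := hf x Ux (size vs).
elim/last_ind: vs f {hf} => [|vs v IH] f hf.
  exact: nbhs_singleton (Ck_diff hf).
rewrite size_rcons in hf; case: hf => _ /(_ v) hf.
by rewrite -cats1 foldr_cat /=; apply: IH.
Qed.

End Ck.

(** * Mean value theorem on lines and symmetry of second derivatives *)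

Section Lines.
Context (R : realType).

Lemma is_derive_line (V W : normedModType R) (F : V -> W) p u (s : R) :
  differentiable F (p + s *: u) ->
  is_derive s (1 : R) (fun s => F (p + s *: u)) ('D_u F (p + s *: u)).
Proof.
move=> dF.
have dg : is_diff s (fun s : R => p + s *: u) ( *:%R^~ u).
  apply: is_diff_eq (is_diffD (is_diff_cst p s) (is_diff_scalel s u)) _.
  by rewrite add0r.
have dc := @differentiable_comp _ _ _ _ (fun s : R => p + s *: u) F _
  (@ex_diff _ _ _ _ _ _ _ dg) dF.
apply: DeriveDef; first exact: diff_derivable.
rewrite (@derive_comp _ _ _ _ (fun s : R => p + s *: u) F) //.
by rewrite [X in 'D_X F _](deriveE _ (@ex_diff _ _ _ _ _ _ _ dg)) diff_val scale1r.
Qed.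

Lemma MVT_line (V : normedModType R) (F : V -> R) p u (h : R) : 0 < h ->
  (forall s, 0 <= s <= h -> differentiable F (p + s *: u)) ->
  exists2 s, 0 <= s <= h & F (p + h *: u) - F p = 'D_u F (p + s *: u) * h.
Proof.
move=> h0 dF.
have [s||s hs e] := @MVT _ (fun s => F (p + s *: u))
  (fun s => 'D_u F (p + s *: u)) 0 h h0.
- rewrite in_itv /= => /andP[s0 sh]; apply: is_derive_line; apply: dF.
  by rewrite !ltW.
- apply: derivable_within_continuous => s; rewrite in_itv /= => sI.
  by have := is_derive_line (dF _ sI); case.
- exists s; first by move: hs; rewrite in_itv /= => /andP[s0 sh]; rewrite !ltW.
  by move: e; rewrite scale0r addr0 subr0.
Qed.

(* Two applications of the mean value theorem turn the second difference into
   [h ^ 2] times a mixed derivative at a point close to [x]. *)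
Lemma second_difference (V : normedModType R) (F : V -> R) x u v (e : R) :
  Ck 2 F x -> 0 < e -> \forall h \near 0^'+,
  `|F (x + h *: u + h *: v) - F (x + h *: u) - (F (x + h *: v) - F x)
    - h * h * 'D_v ('D_u F) x| <= h * h * e.
Proof.
move=> [dF DF] e0.
have [dDF DDF] := DF u.
have [dDDF _] := DDF v.
have cont : {for x, continuous ('D_v ('D_u F))}.
  by apply: differentiable_continuous; exact: nbhs_singleton dDDF.
have nr : \forall y \near x, [/\ differentiable F y, differentiable ('D_u F) y
     & `|'D_v ('D_u F) x - 'D_v ('D_u F) y| < e].
  move/cvgrPdist_lt: cont => /(_ _ e0) h3.
  by near=> y; split; near: y.
have [r /= r0 br] := proj1 (nbhs_ballP _ _) nr.
(* For [0 < h < d] the parallelogram at [x] with sides [h *: u] and [h *: v] lies in the ball of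
   radius [r]; the summand 1 keeps the denominator positive. *)
pose d := r / (`|u| + `|v| + 1).
have p0 : 0 < `|u| + `|v| + 1 by rewrite ltr_wpDl // addr_ge0.
have d0 : 0 < d by rewrite divr_gt0.
near=> h.
have h0 : 0 < h by near: h; exact: nbhs_right_gt.
have hd : h < d by near: h; exact: nbhs_right_lt.
have inb s t : 0 <= s <= h -> 0 <= t <= h -> ball x r (x + s *: u + t *: v).
  move=> /andP[s0 sh] /andP[t0 th].
  rewrite -ball_normE /= -addrA opprD addNKr normrN.
  apply: le_lt_trans (ler_normD _ _) _; rewrite !normrZ !ger0_norm //.
  apply: (@le_lt_trans _ _ (h * (`|u| + `|v|))).
    by rewrite mulrDr lerD // ler_wpM2r.
  apply: (@lt_trans _ _ (h * (`|u| + `|v| + 1))).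
    by rewrite ltr_pM2l // ltrDl.
  by rewrite -ltr_pdivlMr.
have hh : 0 <= h <= h by rewrite lexx ltW.
have zz : (0 : R) <= 0 <= h by rewrite lexx ltW.
have sw s t : x + t *: v + s *: u = x + s *: u + t *: v by rewrite addrAC.
have [|s sI e1] := @MVT_line _ (fun y => F (y + h *: v) - F y) x u h h0.
  move=> s sI; apply: differentiableB.
    rewrite -[fun y => _]/(F \o (fun y => y + h *: v)).
    apply: differentiable_comp => //.
    by have [] := br _ (inb _ _ sI hh).
  by have := br _ (inb _ _ sI zz); rewrite scale0r addr0 => -[].
have dFs : 'D_u (fun y => F (y + h *: v) - F y) (x + s *: u) =
   'D_u F (x + s *: u + h *: v) - 'D_u F (x + s *: u).
  have d1 : differentiable F (x + s *: u) by
    have := br _ (inb _ _ sI zz); rewrite scale0r addr0 => -[].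
  have d2 : differentiable F (x + s *: u + h *: v) by
    have := br _ (inb _ _ sI hh) => -[].
  have d3 : is_diff (x + s *: u) (fun y => y + h *: v) id.
    apply: is_diff_eq (is_diffD (is_diff_id _) (is_diff_cst (h *: v) _)) _.
    by rewrite addr0.
  have d4 := @differentiable_comp _ _ _ _ (fun y => y + h *: v) F _
    (@ex_diff _ _ _ _ _ _ _ d3) d2.
  rewrite -[fun y => _]/((F \o (fun y => y + h *: v)) - F).
  rewrite (deriveB (diff_derivable d4) (diff_derivable d1)).
  rewrite (@derive_comp _ _ _ _ (fun y => y + h *: v) F) //.
  by rewrite [X in 'D_X F _](deriveE _ (@ex_diff _ _ _ _ _ _ _ d3)) diff_val.
rewrite e1 dFs.
have [|t tI ->] := @MVT_line _ ('D_u F) (x + s *: u) v h h0.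
  by move=> t tI; have [] := br _ (inb _ _ sI tI).
have [_ _ /ltW close] := br _ (inb _ _ sI tI).
rewrite -mulrA [_ * (h * h)]mulrC -mulrBr normrM distrC.
by have hh0 := mulr_gt0 h0 h0; rewrite (ger0_norm (ltW hh0)) ler_pM2l.
Unshelve. all: by end_near. Qed.

Lemma diff_quotient_close (a b c d h X Y e : R) : 0 < h ->
  `|c - a - (b - d) - h * X| <= h * e -> `|c - b - (a - d) - h * Y| <= h * e ->
  `|Y - X| <= e + e.
Proof.
move=> h0 H1 H2; rewrite -(ler_pM2l h0).
rewrite -[X in X * `|_|](ger0_norm (ltW h0)) -normrM.
have -> : h * (Y - X) =
  (c - a - (b - d) - h * X) - (c - b - (a - d) - h * Y) by ring.
by apply: le_trans (ler_normB _ _) _; rewrite mulrDr lerD.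
Qed.

(** The second difference is symmetric in [u] and [v]; divided by [h * h] it is within [e / 2] of
    either mixed derivative for small [h > 0]. *)
Lemma derive_sym (V : normedModType R) (F : V -> R) x u v :
  Ck 2 F x -> 'D_u ('D_v F) x = 'D_v ('D_u F) x.
Proof.
move=> CF; apply/eqP; rewrite -subr_eq0 -normr_le0; apply/ler_addgt0Pl => e e0.
have e2 : 0 < e / 2 by rewrite divr_gt0.
have [h [[H1 H2] h0]] := filter_ex (filterI (filterI
  (second_difference u v CF e2) (second_difference v u CF e2))
  (@nbhs_right_gt _ (0 : R))).
rewrite (addrAC x (h *: v)) in H2.
rewrite addr0 (splitr e).
exact: diff_quotient_close (mulr_gt0 h0 h0) H1 H2.
Qed.

End Lines.

(** * A flat smooth function on the real line *)

Section FlatExp.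
Context (R : realType).

(** The case [m = 0] is the classical [exp (-1/t)] extended by 0. The powers of [t^-1] make the span
    of the family closed under differentiation, so smoothness follows by induction. *)
Definition flat_exp (m : nat) (t : R) : R :=
  if 0 < t then t^-1 ^+ m * expR (- t^-1) else 0.

(* With [x = t^-1] and [N = m.+1], this is [(x / N) ^ N <= expR x]. *)
Lemma flat_exp_bound m t : 0 < t -> flat_exp m t <= (m.+1)%:R ^+ m.+1 * t.
Proof.
move=> t0; rewrite /flat_exp t0; set N := m.+1; set x := t^-1.
have x0 : 0 < x by rewrite invr_gt0.
have N0 : (0 : R) < N%:R by rewrite ltr0n.
have : (x / N%:R) ^+ N <= expR x.
  rewrite -[X in expR X](divfK (lt0r_neq0 N0)) [_ * N%:R]mulrC expRM_natl.
  rewrite ler_pXn2r // ?nnegrE ?expR_ge0 ?(divr_ge0 (ltW x0) (ltW N0)) //.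
  by apply: le_trans _ (expR_ge1Dx _); rewrite lerDr.
rewrite expr_div_n ler_pdivrMr ?exprn_gt0 // => h.
have -> : t = x^-1 by rewrite invrK.
rewrite expRN ler_pdivrMr ?expR_gt0 // mulrAC ler_pdivlMr //.
by rewrite -exprSr mulrC.
Qed.

Lemma flat_exp_derive m (t : R) :
  is_derive t 1 (flat_exp m) (- m%:R * flat_exp m.+1 t + flat_exp m.+2 t).
Proof.
have [t0|t0|<-] := ltgtP 0 t.
- rewrite /flat_exp t0.
  refine (@near_eq_is_derive _ _ _ (fun s : R => s^-1 ^+ m * expR (- s^-1)) _ _ _ _ _ _).
    near=> s; rewrite ifT //; near: s; exact: lt_nbhsr.
  have tn : t != 0 by rewrite gt_eqF.
  have dV : is_derive t (1 : R) (fun s : R => s^-1) (- t^-1 ^+ 2).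
    apply: DeriveDef; first exact: derivableV.
    by rewrite deriveV // derive_id /GRing.scale /= mulr1 exprVn.
  have dX := is_deriveX m dV.
  have dN : is_derive t (1 : R) (fun s : R => - s^-1) (- - t^-1 ^+ 2) := is_deriveN dV.
  have dE := @is_derive1_comp _ expR (fun s : R => - s^-1) t _ _
    (is_derive_expR (- t^-1)) dN.
  have -> : (fun s : R => s^-1 ^+ m * expR (- s^-1)) =
      ((fun s : R => s^-1) ^+ m) * (expR \o (fun s : R => - s^-1)).
    by apply/funext => s; rewrite !fctE.
  apply: is_derive_eq; rewrite /GRing.scale /= !fctE.
  case: m {dX} => [|m] /=; rewrite ?mulr0n ?exprS; last rewrite -mulr_natr; ring.
- rewrite /flat_exp (lt_gtF t0) mulr0 addr0.
  refine (@near_eq_is_derive _ _ _ (fun s : R => 0) _ _ _ _ _ _).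
  near=> s; rewrite ifF //; apply/negbTE; rewrite -leNgt ltW //.
  by near: s; exact: lt_nbhsl.
- have f0 k : flat_exp k (0 : R) = 0 by rewrite /flat_exp ltxx.
  rewrite !f0 mulr0 addr0.
  (* At 0 the difference quotient is [flat_exp m.+1 h] for [h > 0], which the linear bound sends to
     0, and it is 0 for [h < 0]. *)
  have c : (h^-1 *: (flat_exp m (h *: 1 + 0) - flat_exp m 0)) @[h --> (0:R)^'] --> (0 : R).
    apply/cvgrPdist_le => e e0; rewrite f0.
    have C0 : (0 : R) < (m.+2)%:R ^+ m.+2 by rewrite exprn_gt0 // ltr0n.
    near=> h; rewrite addr0 subr0 sub0r normrN [h *: 1]mulr1.
    have [h0|h0] := ltP 0 h; last first.
      by rewrite /flat_exp ltNge h0 /= scaler0 normr0 (ltW e0).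
    have -> : h^-1 *: flat_exp m h = flat_exp m.+1 h.
      by rewrite /flat_exp h0 /GRing.scale /= exprS mulrA.
    rewrite ger0_norm; last first.
      by rewrite /flat_exp h0 mulr_ge0 ?expR_ge0 // exprn_ge0 // invr_ge0 ltW.
    apply: le_trans (flat_exp_bound _ h0) _.
    rewrite mulrC -ler_pdivlMr // -[X in X <= _](ger0_norm (ltW h0)).
    near: h; apply: dnbhs0_le; exact: divr_gt0.
  by apply: DeriveDef; [apply/cvg_ex; exists 0 | exact: cvg_lim c].
Unshelve. all: by end_near. Qed.

Lemma Ck_flat_exp k m t : Ck k (flat_exp m) t.
Proof.
have d j s : differentiable (flat_exp j) s.
  by apply/derivable1_diffP; case: (flat_exp_derive j s).
elim: k m => [|k IH] m; split => //; try by near=> s.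
move=> v; rewrite (_ : 'D_v _ = fun t =>
    v *: (- m%:R *: flat_exp m.+1 t + flat_exp m.+2 t)).
  by apply: CkZ; apply: CkD => //; exact: CkZ.
apply/funext => s; rewrite (deriveE _ (d _ _)) -[in LHS](mulr1 v).
rewrite -[v * 1]/(v *: 1) linearZ -(deriveE _ (d _ _)) /=.
by have [_ ->] := flat_exp_derive m s.
Unshelve. all: by end_near. Qed.

Lemma flat_exp_ge0 t : 0 <= flat_exp 0 t.
Proof. by rewrite /flat_exp; case: ifP => // _; rewrite mul1r expR_ge0. Qed.

Lemma flat_exp_gt0 t : (0 < flat_exp 0 t) = (0 < t).
Proof. by rewrite /flat_exp; case: ifP => [_|_]; rewrite ?ltxx // mul1r expR_gt0. Qed.

Lemma flat_exp_le0 t : t <= 0 -> flat_exp 0 t = 0.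
Proof. by rewrite /flat_exp ltNge => ->. Qed.

End FlatExp.

(** * Entrywise differentiability of matrix-valued functions *)

Section Ckmx.
Context (R : realType) (V : normedModType R) (k : nat) (x : V).

Definition Ckmx m n (A : V -> 'M[R]_(m, n)) :=
  forall i j, Ck k (fun y => A y i j) x.

Lemma Ckmx_cst m n (A : 'M[R]_(m, n)) : Ckmx (fun=> A).
Proof. by move=> i j; exact: Ck_cst. Qed.

Lemma CkmxD m n (A B : V -> 'M[R]_(m, n)) :
  Ckmx A -> Ckmx B -> Ckmx (fun y => A y + B y).
Proof.
move=> hA hB i j; under eq_fun do rewrite mxE; exact: CkD.
Qed.

Lemma CkmxZ m n a (A : V -> 'M[R]_(m, n)) :
  Ckmx A -> Ckmx (fun y => a *: A y).
Proof.
by move=> hA i j; under eq_fun do rewrite mxE; apply: CkM => //; exact: Ck_cst.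
Qed.

Lemma CkmxN m n (A : V -> 'M[R]_(m, n)) :
  Ckmx A -> Ckmx (fun y => - A y).
Proof.
by move=> hA; under eq_fun do rewrite -scaleN1r; exact: CkmxZ.
Qed.

Lemma Ckmx_tr m n (A : V -> 'M[R]_(m, n)) : Ckmx A -> Ckmx (fun y => (A y)^T).
Proof. by move=> hA i j; under eq_fun do rewrite mxE; exact: hA. Qed.

Lemma Ckmx_mul m n p (A : V -> 'M[R]_(m, n)) (B : V -> 'M[R]_(n, p)) :
  Ckmx A -> Ckmx B -> Ckmx (fun y => A y *m B y).
Proof.
move=> hA hB i j; under eq_fun do rewrite mxE.
by apply: Ck_sum => l _; exact: CkM.
Qed.

Lemma Ck_det n (A : V -> 'M[R]_n) : Ckmx A -> Ck k (fun y => \det (A y)) x.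
Proof.
move=> hA; rewrite /determinant; apply: Ck_sum => s _.
by apply: CkM; [exact: Ck_cst|apply: Ck_prod].
Qed.

(** Near [x] the determinant stays nonzero, and the cofactor formula writes each entry of the
    inverse as a polynomial in the entries of [A] divided by it. *)
Lemma Ckmx_inv n (A : V -> 'M[R]_n) :
  A x \in unitmx -> Ckmx A -> Ckmx (fun y => invmx (A y)).
Proof.
move=> uA hA i j.
have d0 : \det (A x) != 0 by rewrite -unitfE -unitmxE.
have hd := Ck_det hA.
have cd : \forall y \near x, \det (A y) != 0.
  apply: cvgr_neq0 d0.
  exact: (@differentiable_continuous _ _ _ x (fun y => \det (A y))
    (nbhs_singleton (Ck_diff hd))).
apply: (@Ck_near _ _ _ _
  (fun y => (\det (A y))^-1 * ((-1) ^+ (j + i) * \det (row' j (col' i (A y)))))).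
  apply: filterS cd => y dy.
  by rewrite /invmx unitmxE unitfE dy !mxE.
apply: CkM; first exact: CkV.
apply: CkM; first exact: Ck_cst.
apply: Ck_det => a b; under eq_fun do rewrite !mxE; exact: hA.
Qed.

Lemma Ckmx_row n (A : V -> 'rV[R]_n) : Ckmx A <-> Ck k A x.
Proof.
split=> [hA|hA i j]; first by apply/Ck_rowP => j; exact: hA.
by rewrite ord1; move: j; apply/Ck_rowP.
Qed.

Lemma Ck_bil n (A : V -> 'M[R]_n) (u v : V -> 'rV[R]_n) :
  Ckmx A -> Ck k u x -> Ck k v x -> Ck k (fun y => bil (A y) (u y) (v y)) x.
Proof.
move=> hA /Ckmx_row hu /Ckmx_row hv; apply: (Ckmx_mul _ (Ckmx_tr hv)).
exact: Ckmx_mul.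
Qed.

End Ckmx.

(** * Symmetric bilinear forms of index one *)

Section Bilinear.
Context (R : realType) (n : nat).
Implicit Types (G H W : 'M[R]_n) (u v w : 'rV[R]_n) (D : 'cV[R]_n).

Lemma bilDl G u v w : bil G (u + v) w = bil G u w + bil G v w.
Proof. by rewrite /bil !mulmxDl mxE. Qed.

Lemma bilDr G u v w : bil G w (u + v) = bil G w u + bil G w v.
Proof. by rewrite /bil linearD mulmxDr mxE. Qed.

Lemma bilZl G a u v : bil G (a *: u) v = a * bil G u v.
Proof. by rewrite /bil -!scalemxAl mxE. Qed.

Lemma bilZr G a u v : bil G u (a *: v) = a * bil G u v.
Proof. by rewrite /bil linearZ -scalemxAr mxE. Qed.

Lemma bilNl G u v : bil G (- u) v = - bil G u v.
Proof. by rewrite -scaleN1r bilZl mulN1r. Qed.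

Lemma bilNr G u v : bil G u (- v) = - bil G u v.
Proof. by rewrite -scaleN1r bilZr mulN1r. Qed.

Lemma bil0l G v : bil G 0 v = 0.
Proof. by rewrite /bil !mul0mx mxE. Qed.

Lemma bilC G u v : G^T = G -> bil G u v = bil G v u.
Proof.
move=> sG; rewrite /bil -[in RHS]sG -[u *m G *m v^T]trmxK mxE.
by rewrite !trmx_mul trmxK mulmxA.
Qed.

Lemma bil_mull m G (u : 'rV[R]_m) (A : 'M[R]_(m, n)) (B : 'M[R]_(m, n)) (v : 'rV[R]_m) :
  bil G (u *m A) (v *m B) = bil (A *m G *m B^T) u v.
Proof. by rewrite /bil trmx_mul !mulmxA. Qed.

Lemma bil_addmx G H u v : bil (G + H) u v = bil G u v + bil H u v.
Proof. by rewrite /bil mulmxDr mulmxDl mxE. Qed.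

Lemma bil_sum (I : Type) (r : seq I) (G : I -> 'M[R]_n) u v :
  bil (\sum_(i <- r) G i) u v = \sum_(i <- r) bil (G i) u v.
Proof.
apply: (big_morph (fun A => bil A u v)) => [A B|]; first exact: bil_addmx.
by rewrite /bil mulmx0 mul0mx mxE.
Qed.

Lemma bil_scale a G u v : bil (a *: G) u v = a * bil G u v.
Proof. by rewrite /bil -scalemxAr -scalemxAl mxE. Qed.

Definition posdef H := H^T = H /\ forall v, v != 0 -> 0 < bil H v v.

Lemma bil_kerP G v : bil_kernel G v <-> v *m G = 0.
Proof.
split=> [h|h w]; last by rewrite /bil h mul0mx mxE.
apply/rowP => j; have := h (delta_mx 0 j).
by rewrite /bil trmx_delta -colE !mxE.
Qed.

Definition form D v : R := (v *m D) 0 0.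

Lemma formD D u v : form D (u + v) = form D u + form D v.
Proof. by rewrite /form mulmxDl mxE. Qed.

Lemma formZ D a u : form D (a *: u) = a * form D u.
Proof. by rewrite /form -scalemxAl mxE. Qed.

Lemma formN D u : form D (- u) = - form D u.
Proof. by rewrite -scaleN1r formZ mulN1r. Qed.

Lemma form_continuous D : continuous (form D).
Proof.
move=> v; apply: differentiable_continuous.
have : Ck 0 (form D) v.
  apply: (@Ckmx_mul _ _ _ _ _ _ _ (fun y => y) (fun=> D)).
    exact/Ckmx_row/Ck_id.
  exact: Ckmx_cst.
by move=> /Ck_diff; exact: nbhs_singleton.
Qed.

(** If [bil G w w < 0], the orthogonal vectors [v] and [w] would span a negative definite plane,
    which index 1 forbids. *)
Lemma timelike_perp G v w : G^T = G -> has_index G 1 -> bil G v v < 0 ->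
  bil G v w = 0 -> 0 <= bil G w w.
Proof.
move=> sG [_ ub] qv vw; rewrite leNgt; apply/negP => qw.
have wv : bil G w v = 0 by rewrite bilC.
have qE a b : bil G (a *: v + b *: w) (a *: v + b *: w) =
    a ^+ 2 * bil G v v + b ^+ 2 * bil G w w.
  rewrite !(bilDl, bilDr, bilZl, bilZr) vw wv; ring.
have : (\rank (v + w)%MS <= 1)%N.
  apply: ub => u /sub_addsmxP[[a b] /= ->].
  rewrite [a]mx11_scalar [b]mx11_scalar !mul_scalar_mx.
  set a' := a 0 0; set b' := b 0 0 => ne; rewrite qE.
  have [a0|a0] := eqVneq a' 0.
    have [b0|b0] := eqVneq b' 0.
      by move: ne; rewrite a0 b0 !scale0r addr0 eqxx.
    by rewrite a0 expr0n mul0r add0r nmulr_llt0 // exprn_even_gt0.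
  rewrite -(addr0 0) ltr_leD //; first by rewrite nmulr_llt0 // exprn_even_gt0.
  by rewrite nmulr_lle0 // sqr_ge0.
have vn0 : v != 0 by apply: contraTneq qv => ->; rewrite bil0l ltxx.
have wn0 : w != 0 by apply: contraTneq qw => ->; rewrite bil0l ltxx.
rewrite mxrank_disjoint_sum ?rank_rV ?vn0 ?wn0 //.
apply/eqP; rewrite -submx0; apply/rV_subP => u; rewrite sub_capmx.
move=> /andP[/sub_rVP[a ->] /sub_rVP[b eb]].
have : bil G (a *: v) (a *: v) = 0 by rewrite {2}eb bilZl bilZr vw !mulr0.
rewrite bilZl bilZr mulrA => /eqP; rewrite mulf_eq0 (lt_eqF qv) orbF mulf_eq0 orbb.
by move=> /eqP ->; rewrite scale0r sub0mx.
Qed.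

(** The form is positive semidefinite on the complement of [v], so a null vector there is orthogonal
    to all of it, by the argument of Cauchy and Schwarz; together with [v] the complement spans the
    space. *)
Lemma null_perp_ker G v w : G^T = G -> has_index G 1 -> bil G v v < 0 ->
  bil G v w = 0 -> bil G w w = 0 -> bil_kernel G w.
Proof.
move=> sG iG qv vw qw.
have key u : bil G v u = 0 -> bil G w u = 0.
  move=> vu; apply/eqP/negPn/negP => wu.
  have pq t : 0 <= 2 * t * bil G w u + t ^+ 2 * bil G u u.
    have := @timelike_perp G v (w + t *: u) sG iG qv.
    rewrite bilDr bilZr vw vu mulr0 addr0 => /(_ erefl).
    rewrite !(bilDl, bilDr, bilZl, bilZr) qw (bilC u w sG) => h.
    apply: le_trans h _; rewrite le_eqVlt; apply/orP; left; apply/eqP; ring.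
  have qu : 0 <= bil G u u by exact: timelike_perp vu.
  set b := bil G w u in wu pq; set c := bil G u u in pq qu.
  have c1 : 0 < c + 1 by rewrite ltr_wpDl.
  (* The minimiser would be [- b / c], but [c] may vanish; with [c + 1] the value is still negative
     when [b != 0]. *)
  have := pq (- b / (c + 1)).
  have -> : 2 * (- b / (c + 1)) * b + (- b / (c + 1)) ^+ 2 * c =
     - (b ^+ 2 * (c + 2)) / (c + 1) ^+ 2 by field; rewrite gt_eqF.
  rewrite pmulr_lge0 ?invr_gt0 ?exprn_gt0 // oppr_ge0 leNgt => /negP; apply.
  by rewrite mulr_gt0 ?exprn_even_gt0 // (lt_trans c1) // ltrD2l ltr1n.
move=> u; have qv0 : bil G v v != 0 by rewrite lt_eqF.
have := key (u - (bil G v u / bil G v v) *: v).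
rewrite bilDr bilNr bilZr divfK // subrr => /(_ erefl).
by rewrite bilDr bilNr bilZr (bilC w v sG) vw mulr0 subr0.
Qed.

(** A subspace of dimension at least two meets the kernel of [D], of codimension at most one, in a
    nonzero vector, where the form is nonnegative. Both modified metrics get their index from
    this. *)
Lemma has_index1 G D v : bil G v v < 0 ->
  (forall w, form D w = 0 -> 0 <= bil G w w) -> has_index G 1.
Proof.
move=> qv hD; split.
  exists (<<v>>)%MS; last first.
    by rewrite mxrank_gen rank_rV; case: eqP qv => // ->; rewrite bil0l ltxx.
  move=> u; rewrite genmxE => /sub_rVP[a ->]; rewrite scaler_eq0 negb_or => /andP[a0 _].
  by rewrite bilZl bilZr mulrA nmulr_llt0 // -expr2 exprn_even_gt0.
move=> W nW; rewrite leqNgt; apply/negP => rW.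
have : (0 < \rank (W :&: kermx D)%MS)%N.
  have := mxrank_sum_cap W (kermx D).
  have := rank_leq_col (W + kermx D)%MS.
  rewrite mxrank_ker; have := rank_leq_col D; have := rank_leq_col W.
  move: rW; set a := \rank W; set b := \rank D; set c := \rank (_ + _)%MS.
  set e := \rank (_ :&: _)%MS; lia.
rewrite lt0n mxrank_eq0 => /rowV0Pn[u].
rewrite sub_capmx => /andP[uW /sub_kermxP uD] u0.
have := nW u uW u0; rewrite ltNge hD //.
by rewrite /form uD mxE.
Qed.

Lemma index1_timelike G : has_index G 1 -> exists v, bil G v v < 0.
Proof.
move=> [[W nW rW] _].
have : W != 0 by rewrite -mxrank_eq0 rW.
by move=> /rowV0Pn[v vW v0]; exists v; exact: nW.
Qed.

End Bilinear.

(** * Causal cones and the linear forms separating their two halves *)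

Section Cones.
Context (R : realType) (n : nat).
Implicit Types (G : 'M[R]_n) (u v w : 'rV[R]_n) (D : 'cV[R]_n).

Definition causal G : set 'rV[R]_n :=
  [set v | ~ bil_kernel G v /\ bil G v v <= 0].

(** The pointwise trace of a temporal function: the first clause controls the index, the second lets
    the sign of [D] split the causal vectors, the third is infinitesimal basicness. *)
Definition cone_form G D :=
  [/\ forall w, form D w = 0 -> 0 <= bil G w w,
      forall w, causal G w -> form D w <> 0 &
      forall w, bil_kernel G w -> form D w = 0].

Lemma segment_in_component (A : set 'rV[R]_n) u v :
  (forall t : R, 0 <= t <= 1 -> A ((1 - t) *: u + t *: v)) ->
  connected_component A u v.
Proof.
move=> hA; pose f (t : R) := (1 - t) *: u + t *: v.
have cf : continuous f.
  move=> t; apply: differentiable_continuous; apply: differentiableD.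
    apply: differentiableZl; apply: differentiableB => //.
  exact: differentiableZl.
have cI : connected (f @` `[0, 1]).
  apply: connected_continuous_connected; first exact: segment_connected.
  exact: continuous_subspaceT.
apply: (connected_component_max _ _ cI).
- by exists 0; [rewrite /= in_itv /= lexx ler01|rewrite /f subr0 scale1r scale0r addr0].
- by move=> _ [t + <-]; rewrite /= in_itv /=; exact: hA.
- by exists 1; [rewrite /= in_itv /= lexx ler01|rewrite /f subrr scale1r scale0r add0r].
Qed.

Lemma causalN G v : causal G v -> causal G (- v).
Proof.
move=> [kv qv]; split; last by rewrite bilNl bilNr opprK.
by move=> h; apply: kv => w; rewrite -(opprK v) bilNl h oppr0.
Qed.

Lemma cone_convex G D u v a b : G^T = G -> cone_form G D ->
  causal G u -> causal G v -> 0 < form D u -> 0 < form D v ->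
  0 <= a -> 0 <= b -> 0 < a + b ->
  causal G (a *: u + b *: v) /\ 0 < form D (a *: u + b *: v).
Proof.
move=> sG [H1 H2 H3] [ku qu] [kv qv] du dv a0 b0 ab.
have dd : 0 < form D (a *: u + b *: v).
  rewrite formD !formZ; have [ae|an] := eqVneq a 0.
    by move: ab; rewrite ae add0r mul0r add0r => b1; exact: mulr_gt0.
  have a1 : 0 < a by rewrite lt0r an.
  by rewrite ltr_pwDl // ?mulr_gt0 // mulr_ge0 // ltW.
split=> //; split; first by move=> /H3 h; move: dd; rewrite h ltxx.
have uv : bil G u v <= 0.
  (* This combination lies in the kernel of [D], where the form is nonnegative. As [u] and [v] are
     causal with positive [D], expanding the square forces [bil G u v <= 0]. *)
  have := H1 (form D v *: u - form D u *: v).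
  rewrite formD formN !formZ mulrC subrr => /(_ erefl).
  rewrite !(bilDl, bilDr, bilNl, bilNr, bilZl, bilZr) (bilC v u sG) => h.
  rewrite leNgt; apply/negP => uv.
  have h1 : form D u * (form D u * bil G v v) <= 0 by rewrite !pmulr_rle0.
  have h2 : form D v * (form D v * bil G u u) <= 0 by rewrite !pmulr_rle0.
  have h3 : 0 < form D u * (form D v * bil G u v) by rewrite !mulr_gt0.
  move: h h1 h2 h3; set x := form D u; set y := form D v; set p := bil G u v; lra.
rewrite !(bilDl, bilDr, bilZl, bilZr) (bilC v u sG).
have h1 : a * (a * bil G u u) <= 0 by rewrite !mulr_ge0_le0.
have h2 : b * (b * bil G v v) <= 0 by rewrite !mulr_ge0_le0.
have h3 : a * (b * bil G u v) <= 0 by rewrite !mulr_ge0_le0.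
by lra.
Qed.

Lemma form_sign_component G D v w : (forall w, causal G w -> form D w <> 0) ->
  0 < form D v -> connected_component (causal G) v w -> 0 < form D w.
Proof.
move=> H2 dv [A [Av sA cA] Aw]; rewrite ltNge; apply/negP => dw.
have cD : connected (form D @` A).
  apply: connected_continuous_connected => //.
  exact/continuous_subspaceT/form_continuous.
have /connected_intervalP/(_ (form D w) (form D v)) iD := cD.
have [] := iD _ _ 0; first by exists w.
- by exists v.
- by rewrite dw ltW.
by move=> z Az; exact: H2 (sA _ Az).
Qed.

(** By convexity, segments between causal vectors with positive [D] stay causal; conversely [D] has
    no zero on causal vectors and so keeps its sign on a component. *)
Lemma cone_component G D v : G^T = G -> cone_form G D ->
  causal G v -> 0 < form D v ->
  connected_component (causal G) v = [set w | causal G w /\ 0 < form D w].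
Proof.
move=> sG cf cv dv; have [H1 H2 H3] := cf; apply/seteqP; split=> w.
  move=> vw; split; first exact: connected_component_sub vw.
  exact: form_sign_component vw.
move=> [cw dw]; apply: segment_in_component => t /andP[t0 t1].
by have [] // := @cone_convex G D v w (1 - t) t sG cf cv cw dv dw; lra.
Qed.

(** The dual form of [t], with a minus sign to make it positive at [t] itself. Its kernel is the
    complement of [t], so [timelike_perp] and [null_perp_ker] give the clauses. *)
Lemma lorentz_cone_form G t : G^T = G -> has_index G 1 -> bil G t t < 0 ->
  cone_form G (- G *m t^T).
Proof.
move=> sG iG qt.
have fE w : form (- G *m t^T) w = - bil G w t.
  by rewrite /form /bil mulNmx mulmxN mxE mulmxA.
split=> w; rewrite fE.
- by move=> /eqP; rewrite oppr_eq0 => /eqP h; apply: timelike_perp qt _; rewrite // bilC.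
- move=> [kw qw] /eqP; rewrite oppr_eq0 (bilC w t sG) => /eqP wt; apply: kw.
  apply: (null_perp_ker sG iG qt wt); apply: le_anti; rewrite qw /=.
  exact: timelike_perp sG iG qt wt.
- by move=> ->; rewrite oppr0.
Qed.

(** Through the dual form of an auxiliary timelike [t], the wedge of [v] and its opposite exhaust
    the causal vectors, so [D] has no zero among them. A zero of [D] with negative square would be
    such a zero. *)
Lemma positive_cone_form G D v : G^T = G -> has_index G 1 -> causal G v ->
  (forall w, connected_component (causal G) v w -> 0 < form D w) ->
  cone_form G D.
Proof.
move=> sG iG cv hD.
(* Replacing [t] by [- t] if necessary makes its dual form positive at [v]; [bil G v t] cannot
   vanish because [v] is causal. *)
have [t [qt tv]] : exists t, bil G t t < 0 /\ bil G v t < 0.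
  have [t qt] := index1_timelike iG.
  have [_ /(_ v cv) + _] := lorentz_cone_form sG iG qt.
  rewrite /form mulNmx mulmxN mxE mulmxA -/(bil G v t).
  have [tv _|tv _|->] := ltgtP (bil G v t) 0; last by rewrite oppr0.
    by exists t.
  by exists (- t); rewrite bilNl !bilNr opprK oppr_lt0.
have cf := lorentz_cone_form sG iG qt; have [H1 H2 H3] := cf.
have vD : 0 < form (- G *m t^T) v.
  by rewrite /form mulNmx mulmxN mxE mulmxA -/(bil G v t) oppr_gt0.
have E := cone_component sG cf cv vD.
have P w : causal G w -> form D w <> 0.
  move=> cw; have := H2 w cw.
  have [w0|w0|->//] := ltgtP (form (- G *m t^T) w) 0 => _.
    have : 0 < form D (- w).
      by apply: hD; rewrite E; split; [exact: causalN|rewrite formN oppr_gt0].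
    by rewrite formN oppr_gt0 => + h; rewrite h ltxx.
  have : 0 < form D w by apply: hD; rewrite E; split.
  by move=> + h; rewrite h ltxx.
(* [v + c *: w] stays in the component of [v] for every scalar [c]. *)
have K w : bil_kernel G w -> form D w = 0.
  move=> kw; have wl u : bil G u w = 0 by rewrite bilC.
  have pos c : 0 < form D v + c * form D w.
    rewrite -formZ -formD; apply: hD; rewrite E; split; last first.
      by rewrite formD formZ (H3 w kw) mulr0 addr0.
    case: cv => kv qv; split.
      move=> h; apply: kv => u; have := h u.
      by rewrite bilDl bilZl kw mulr0 addr0.
    by rewrite !(bilDl, bilDr, bilZl, bilZr) kw wl !mulr0 kw !mulr0 !addr0.
  apply/eqP/negPn/negP => dw; have := pos (- form D v / form D w).
  by rewrite divfK // subrr ltxx.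
split=> // w dw; rewrite leNgt; apply/negP => qw.
apply: (P w) => //; split; last exact: ltW.
by move=> /(_ w) h; move: qw; rewrite h ltxx.
Qed.

End Cones.

(** * Tangent vectors and tensors in charts *)

Section Charts.
Context (R : realType) (n : nat) (M : manifold R n).
Implicit Types (c d e : chart R n M) (x : M).

Lemma near_bwd c x (P : set M) : dom c x -> nbhs x P ->
  \forall y \near fwd c x, P (bwd c y).
Proof. by move=> dx; rewrite -{1}(fwdK dx) => /(bwd_continuous dx). Qed.

Lemma near_fwd c x (P : set 'rV[R]_n) : dom c x -> nbhs (fwd c x) P ->
  \forall z \near x, P (fwd c z).
Proof. by move=> dx; exact: fwd_continuous. Qed.

Lemma near_dom c x : dom c x -> \forall z \near x, dom c z.
Proof. by move=> dx; apply: open_nbhs_nbhs; split=> //; exact: dom_open. Qed.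

Lemma near_bwdK c x : dom c x -> \forall y \near fwd c x, fwd c (bwd c y) = y.
Proof.
move=> dx; have : nbhs (fwd c x) (fwd c @` dom c).
  by apply: open_nbhs_nbhs; split; [exact: img_open|exists x].
by apply: filterS => _ [z dz <-]; rewrite fwdK.
Qed.

Lemma open_fwd c (U : set M) : open U -> open (fwd c @` (U `&` dom c)).
Proof.
move=> oU; rewrite openE => _ [x [Ux dx] <-].
have n1 := near_bwd dx (open_nbhs_nbhs (conj oU Ux)).
have n2 := near_bwd dx (near_dom dx); have n3 := near_bwdK dx.
near=> y; exists (bwd c y); last by near: y.
by split; near: y.
Unshelve. all: by end_near. Qed.

Lemma open_fwdI c d : open (fwd c @` (dom c `&` dom d)).
Proof. by rewrite setIC; apply: open_fwd; exact: dom_open. Qed.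

Definition trans c d := fwd d \o bwd c.

Lemma Ck_trans c d x k : atlas c -> atlas d -> dom c x -> dom d x ->
  Ck k (trans c d) (fwd c x).
Proof.
move=> ac ad cx dx; have := atlas_compatible ac ad.
by move=> /(smooth_onP _ (open_fwdI (c:=c) (d:=d))); apply; exists x.
Qed.

Lemma diff_trans c d x : atlas c -> atlas d -> dom c x -> dom d x ->
  differentiable (trans c d) (fwd c x).
Proof.
by move=> ac ad cx dx; exact: nbhs_singleton (Ck_diff (Ck_trans 0 ac ad cx dx)).
Qed.

Lemma near_trans_comp (T : Type) (f : M -> T) c d x : dom c x -> dom d x ->
  \forall y \near fwd c x, f (bwd d (trans c d y)) = f (bwd c y).
Proof.
move=> cx dx; have := near_bwd cx (near_dom dx).
by apply: filterS => y dy; rewrite /trans /= fwdK.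
Qed.

Lemma transE c d x : dom c x -> trans c d (fwd c x) = fwd d x.
Proof. by move=> cx; rewrite /trans /= fwdK. Qed.

Definition Jac c d x : 'M[R]_n :=
  \matrix_i 'D_(delta_mx 0 i) (trans c d) (fwd c x).

Lemma JacE c d x v : atlas c -> atlas d -> dom c x -> dom d x ->
  'D_v (trans c d) (fwd c x) = v *m Jac c d x.
Proof.
move=> ac ad cx dx; rewrite derive_rowE; last exact: diff_trans.
by rewrite mulmx_sum_row; apply: eq_bigr => i _; rewrite rowK.
Qed.

Lemma row_mulmx_inj m p (A B : 'M[R]_(m, p)) :
  (forall v : 'rV_m, v *m A = v *m B) -> A = B.
Proof. by move=> h; apply/row_matrixP => i; rewrite !rowE h. Qed.

Lemma Jac_comp c d e x : atlas c -> atlas d -> atlas e ->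
  dom c x -> dom d x -> dom e x -> Jac c d x *m Jac d e x = Jac c e x.
Proof.
move=> ac ad ae cx dx ex; apply: row_mulmx_inj => v.
rewrite mulmxA -!JacE //.
rewrite -(near_eq_derive v (near_trans_comp (fwd e) cx dx)).
have dt := diff_trans ac ad cx dx.
rewrite -[fun y => _]/(trans d e \o trans c d).
by rewrite derive_comp // transE //; exact: diff_trans.
Qed.

Lemma Jac_id c x : atlas c -> dom c x -> Jac c c x = 1%:M.
Proof.
move=> ac cx; apply: row_mulmx_inj => v; rewrite -JacE // mulmx1.
by rewrite (near_eq_derive v (near_bwdK cx)) derive_id.
Qed.

Lemma JacK c d x : atlas c -> atlas d -> dom c x -> dom d x ->
  Jac c d x *m Jac d c x = 1%:M.
Proof. by move=> ac ad cx dx; rewrite Jac_comp // Jac_id. Qed.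

Lemma Ck_Jac c d x k : atlas c -> atlas d -> dom c x -> dom d x ->
  Ckmx k (fwd c x) (fun y => Jac c d (bwd c y)).
Proof.
move=> ac ad cx dx i j.
have [_ /(_ (delta_mx 0 i))] := Ck_trans k.+1 ac ad cx dx.
move=> /Ck_rowP/(_ j); apply: Ck_near.
by apply: filterS (near_bwdK cx) => y e; rewrite mxE e.
Qed.

Let at_ x := atlas_chart_at x.
Let dat x := dom_chart_at x.

Lemma to_chartE c x v : atlas c -> dom c x ->
  to_chart c x v = v *m Jac (chart_at x) c x.
Proof. by move=> ac cx; rewrite -JacE. Qed.

Lemma of_chartE c x v : atlas c -> dom c x ->
  of_chart c x v = v *m Jac c (chart_at x) x.
Proof. by move=> ac cx; rewrite -JacE. Qed.

Lemma to_chartK c x v : atlas c -> dom c x -> of_chart c x (to_chart c x v) = v.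
Proof. by move=> ac cx; rewrite to_chartE // of_chartE // -mulmxA JacK ?mulmx1. Qed.

Lemma to_chart_at x v : to_chart (chart_at x) x v = v.
Proof. by rewrite to_chartE // Jac_id // mulmx1. Qed.

Lemma of_chart_at x v : of_chart (chart_at x) x v = v.
Proof. by rewrite of_chartE // Jac_id // mulmx1. Qed.

Definition smooth_at (W : normedModType R) (f : M -> W) x :=
  forall c, atlas c -> dom c x -> forall k, Ck k (f \o bwd c) (fwd c x).

Lemma smooth_funP (W : normedModType R) (U : set M) (f : M -> W) : open U ->
  smooth_fun U f <-> forall x, U x -> smooth_at f x.
Proof.
move=> oU; split=> [sf x Ux c ac cx|sf c ac].
  by apply: ((smooth_onP _ (open_fwd (c:=c) oU)).1 (sf c ac)); exists x.
apply/(smooth_onP _ (open_fwd (c:=c) oU)) => _ [x [Ux cx] <-].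
exact: sf.
Qed.

Lemma smooth_at_diff (W : normedModType R) (f : M -> W) x c :
  smooth_at f x -> atlas c -> dom c x -> differentiable (f \o bwd c) (fwd c x).
Proof.
by move=> sf ac cx; exact: nbhs_singleton (Ck_diff (sf c ac cx 0)).
Qed.

Lemma dfun_of_chart (W : normedModType R) (f : M -> W) x c u : smooth_at f x ->
  atlas c -> dom c x ->
  dfun f x (of_chart c x u) = 'D_u (f \o bwd c) (fwd c x).
Proof.
move=> sf ac cx; set a := chart_at x.
have aa : atlas a by exact: at_.
have ax : dom a x by exact: dat.
have ea := near_trans_comp f cx (dat x).
rewrite -(near_eq_derive u ea) -[fun y => _]/((f \o bwd a) \o trans c a).
have da := diff_trans ac aa cx ax.
have df := smooth_at_diff sf aa ax.
by rewrite derive_comp ?transE.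
Qed.

Lemma dfun_to_chart (W : normedModType R) (f : M -> W) x c v : smooth_at f x ->
  atlas c -> dom c x ->
  dfun f x v = 'D_(to_chart c x v) (f \o bwd c) (fwd c x).
Proof. by move=> sf ac cx; rewrite -dfun_of_chart // to_chartK. Qed.

Definition dcol (f : M -> R) x : 'cV[R]_n := \col_i dfun f x (delta_mx 0 i).

Lemma dfunE (f : M -> R) x v : smooth_at f x -> dfun f x v = form (dcol f x) v.
Proof.
move=> sf; rewrite /dfun derive_rowE; last exact: smooth_at_diff.
by rewrite /form mxE; apply: eq_bigr => i _; rewrite mxE.
Qed.

Lemma near_dfun (W : normedModType R) (f g : M -> W) x v :
  (\forall y \near x, f y = g y) -> dfun f x v = dfun g x v.
Proof. by move=> e; apply: near_eq_derive; exact: near_bwd e. Qed.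

(* Components of the (0,2)-tensor field [g] in the chart [c]. *)
Definition trep c (g : M -> 'M[R]_n) y : 'M[R]_n :=
  let x := bwd c y in
  Jac c (chart_at x) x *m g x *m (Jac c (chart_at x) x)^T.

Lemma trepE c g x u v : atlas c -> dom c x ->
  bil (g x) (of_chart c x u) (of_chart c x v) = bil (trep c g (fwd c x)) u v.
Proof. by move=> ac cx; rewrite !of_chartE // bil_mull /trep fwdK. Qed.

Lemma trep_to_chart c g x u v : atlas c -> dom c x ->
  bil (g x) u v = bil (trep c g (fwd c x)) (to_chart c x u) (to_chart c x v).
Proof. by move=> ac cx; rewrite -trepE // !to_chartK. Qed.

Lemma near_trepE c g x u v : atlas c -> dom c x ->
  \forall y \near fwd c x,
    bil (g (bwd c y)) (of_chart c (bwd c y) u) (of_chart c (bwd c y) v) =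
    bil (trep c g y) u v.
Proof.
move=> ac cx; have n1 := near_bwd cx (near_dom cx); have n2 := near_bwdK cx.
by apply: filterS (filterI n1 n2) => y [dy e]; rewrite (trepE g u v ac dy) e.
Qed.

Lemma mx_bil (G : 'M[R]_n) i j : G i j = bil G (delta_mx 0 i) (delta_mx 0 j).
Proof. by rewrite /bil -rowE trmx_delta -colE !mxE. Qed.

(** The matrix [g x] refers to [chart_at x], so its own entries need not be continuous in [x].
    Passing to [trep] in a fixed chart makes the entrywise matrix calculus available. *)
Lemma smooth_tensorP (g : M -> 'M[R]_n) :
  smooth_tensor g <->
  forall c x, atlas c -> dom c x -> forall k, Ckmx k (fwd c x) (trep c g).
Proof.
have oc c : open (fwd c @` dom c) by exact: img_open.
split=> [sg c x ac cx k i j|sg c ac u v].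
  under eq_fun do rewrite mx_bil.
  apply: Ck_near (near_trepE g _ _ ac cx) _.
  by apply: ((smooth_onP _ (oc c)).1 (sg c ac _ _)); exists x.
apply/(smooth_onP _ (oc c)) => _ [x cx <-] k.
apply: (@Ck_near _ _ _ k (fun y => bil (trep c g y) u v)).
  by apply: filterS (near_trepE g u v ac cx).
by apply: Ck_bil; [exact: sg|exact: Ck_cst|exact: Ck_cst].
Qed.

Definition smooth_field_at (X : M -> 'rV[R]_n) x :=
  forall c, atlas c -> dom c x -> forall k, Ck k (vrep c X) (fwd c x).

Lemma smooth_vfieldP (U : set M) (X : M -> 'rV[R]_n) : open U ->
  smooth_vfield U X <-> forall x, U x -> smooth_field_at X x.
Proof.
move=> oU; split=> [sf x Ux c ac cx|sf c ac].
  by apply: ((smooth_onP _ (open_fwd (c:=c) oU)).1 (sf c ac)); exists x.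
apply/(smooth_onP _ (open_fwd (c:=c) oU)) => _ [x [Ux cx] <-].
exact: sf.
Qed.

Lemma vrepE c X x : dom c x -> vrep c X (fwd c x) = to_chart c x (X x).
Proof. by move=> cx; rewrite /vrep fwdK. Qed.

Lemma smooth_at_bil (g : M -> 'M[R]_n) X Y x : smooth_tensor g ->
  smooth_field_at X x -> smooth_field_at Y x ->
  smooth_at (fun y => bil (g y) (X y) (Y y)) x.
Proof.
move=> /smooth_tensorP sg sX sY c ac cx k.
apply: (@Ck_near _ _ _ k (fun y => bil (trep c g y) (vrep c X y) (vrep c Y y))).
  have n1 := near_bwd cx (near_dom cx); have n2 := near_bwdK cx.
  apply: filterS (filterI n1 n2) => y [dy e].
  by rewrite /= (trep_to_chart g _ _ ac dy) e.
by apply: Ck_bil; [exact: sg|exact: sX|exact: sY].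
Qed.

(** The product rule is applied to each coordinate of [X] times a partial derivative of [F];
    symmetry of second derivatives then moves [v] next to [F]. *)
Lemma derive_along (F : 'rV[R]_n -> R) X y v : Ck 2 F y -> Ck 1 X y ->
  'D_v (fun z => 'D_(X z) F z) y =
  'D_('D_v X y) F y + 'D_(X y) ('D_v F) y.
Proof.
move=> CF CX; have dF := Ck_diff CF; have dX := nbhs_singleton (Ck_diff CX).
have [_ DF] := CF.
have dDF w : differentiable ('D_w F) y by have [dw _] := DF w; exact: nbhs_singleton dw.
have ex : \forall z \near y, 'D_(X z) F z =
    \sum_i X z 0 i * 'D_(delta_mx 0 i) F z.
  by apply: filterS dF => z dz; rewrite (derive_rowE _ dz).
have dXi i : derivable (fun z => X z 0 i) y v.
  by apply: diff_derivable; exact: differentiable_coordE.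
rewrite (near_eq_derive v ex).
rewrite (_ : (fun z => _) = \sum_i ((fun z => X z 0 i) * 'D_(delta_mx 0 i) F));
  last by apply/funext => z; rewrite fct_sumE.
have dDi i : derivable ('D_(delta_mx 0 i) F) y v by exact: diff_derivable.
rewrite (derive_sum (fun i => derivableM (dXi i) (dDi i))).
rewrite (derive_rowE ('D_v X y) (nbhs_singleton dF)) (derive_rowE (X y) (dDF v)).
rewrite -big_split /=; apply: eq_bigr => i _.
rewrite (deriveM (dXi i) (dDi i)) (derive_coordE _ _ dX).
rewrite (derive_sym v (delta_mx 0 i) CF) addrC; congr (_ + _).
exact: mulrC.
Qed.

Lemma near_dfun_field (f : M -> R) (X : M -> 'rV[R]_n) x c :
  (forall y, smooth_at f y) -> atlas c -> dom c x ->
  \forall y \near fwd c x,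
    dfun f (bwd c y) (X (bwd c y)) = 'D_(vrep c X y) (f \o bwd c) y.
Proof.
move=> sf ac cx.
have n1 := near_bwd cx (near_dom cx); have n2 := near_bwdK cx.
apply: filterS (filterI n1 n2) => y [dy e].
by rewrite (@dfun_to_chart _ f (bwd c y) c) // /vrep e.
Qed.

Lemma smooth_at_dfun (f : M -> R) (X : M -> 'rV[R]_n) x :
  (forall y, smooth_at f y) -> smooth_field_at X x ->
  smooth_at (fun y => dfun f y (X y)) x.
Proof.
move=> sf sX c ac cx k.
have dF := Ck_diff (sf x c ac cx 0).
apply: (@Ck_near _ _ _ k
  (fun y => \sum_i vrep c X y 0 i * 'D_(delta_mx 0 i) (f \o bwd c) y)).
  have n1 := near_dfun_field X sf ac cx.
  apply: filterS (filterI n1 dF) => y [e dy].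
  by rewrite /= e (derive_rowE _ dy).
apply: Ck_sum => i _; apply: CkM; first by move: i; apply/Ck_rowP; exact: sX.
by have [_] := sf x c ac cx k.+1; apply.
Qed.

(** Each iterated derivative splits by [derive_along] into a first-order term and a second
    derivative of [f]. The latter cancel by symmetry, the former make up the bracket. *)
Lemma dfun_bracket (f : M -> R) (V X : M -> 'rV[R]_n) x :
  (forall y, smooth_at f y) -> smooth_field_at V x -> smooth_field_at X x ->
  dfun f x (bracket V X x) =
  dfun (fun y => dfun f y (X y)) x (V x) - dfun (fun y => dfun f y (V y)) x (X x).
Proof.
move=> sf sV sX; set a := chart_at x.
have aa : atlas a by exact: atlas_chart_at.
have ax : dom a x by exact: dom_chart_at.
have E Y Z : smooth_field_at Y x ->
    dfun (fun y => dfun f y (Y y)) x (Z x) =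
    'D_('D_(Z x) (vrep a Y) (fwd a x)) (f \o bwd a) (fwd a x) +
    'D_(Y x) ('D_(Z x) (f \o bwd a)) (fwd a x).
  move=> sY; rewrite /dfun -/a (near_eq_derive _ (near_dfun_field Y sf aa ax)).
  have := derive_along (Z x) (sf x a aa ax 2) (sY a aa ax 1).
  by rewrite [vrep a Y _](vrepE Y ax) to_chart_at.
rewrite (E X V sX) (E V X sV) (derive_sym (X x) (V x) (sf x a aa ax 2)).
have gen (p r s : R) : p + s - (r + s) = p - r by ring.
rewrite [RHS]gen.
have dF := smooth_at_diff (sf x) aa ax.
rewrite /bracket -/a.
set p := 'D__ (vrep a X) _; set r := 'D__ (vrep a V) _.
have -> : p - r = (- 1) *: r + p by rewrite scaleN1r addrC.
by apply: etrans (derive_lin _ _ _ dF) _; rewrite scaleN1r addrC.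
Qed.

End Charts.

(** * Leaves and basic functions *)

Section LocallyConstant.
Context (R : realType) (p : nat) (L : manifold R p).

(** In a coordinate ball inside [O], the mean value theorem on the segment from the centre gives a
    zero increment. *)
Lemma flat_locally_constant (O : set L) (phi : L -> R) z : open O ->
  (forall z, O z -> smooth_at phi z) ->
  (forall z, O z -> forall w, dfun phi z w = 0) ->
  O z -> \forall z' \near z, phi z' = phi z.
Proof.
move=> oO sp dp Oz; set c := chart_at z.
have ac : atlas c by exact: atlas_chart_at.
have cz : dom c z by exact: dom_chart_at.
have : nbhs (fwd c z) (fwd c @` (O `&` dom c)).
  by apply: open_nbhs_nbhs; split; [exact: open_fwd|exists z].
move=> /nbhs_ballP[r /= r0 br].
have cst y : ball (fwd c z) r y -> (phi \o bwd c) y = phi z.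
  move=> yb; have inb s : 0 <= s <= 1 ->
      ball (fwd c z) r (fwd c z + s *: (y - fwd c z)).
    move=> /andP[s0 s1]; move: yb; rewrite -!ball_normE /= opprD addNKr normrN.
    rewrite normrZ (ger0_norm s0) distrC; apply: le_lt_trans.
    by rewrite ler_piMl.
  have dI s : 0 <= s <= 1 -> exists x, [/\ O x, dom c x &
      fwd c x = fwd c z + s *: (y - fwd c z)].
    by move=> /inb/br[x [Ox cx] e]; exists x.
  have [|s sI] := @MVT_line _ _ (phi \o bwd c) (fwd c z) (y - fwd c z) 1 ltr01.
    move=> s /dI[x [Ox cx <-]]; exact: smooth_at_diff (sp x Ox) ac cx.
  have [x [Ox cx <-]] := dI s sI.
  rewrite -(dfun_of_chart _ (sp x Ox) ac cx) dp // mul0r scale1r addrCA subrr addr0.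
  by move=> /eqP; rewrite subr_eq0 => /eqP ->; rewrite /= fwdK.
have n1 := near_fwd cz (nbhsx_ballx (fwd c z) r r0).
apply: filterS (filterI n1 (near_dom cz)) => z' [/cst e dz'].
by move: e; rewrite /= fwdK.
Qed.

Lemma locally_constant_component (T : topologicalType) (O : set T) (phi : T -> R) z z' :
  open O -> (forall z, O z -> \forall z' \near z, phi z' = phi z) ->
  connected_component O z z' -> phi z' = phi z.
Proof.
move=> oO lc [A [Az sA cA] Az'].
have loc (P : set R) : open (O `&` [set t | P (phi t)]).
  rewrite openE => t [Ot Pt]; have n1 := open_nbhs_nbhs (conj oO Ot).
  by apply: filterS (filterI n1 (lc t Ot)) => s [Os e]; split=> //=; rewrite e.
have : A `&` [set t | phi t = phi z] = A.
  apply: cA; first by exists z.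
  - exists (O `&` [set t | phi t = phi z]); first exact: (loc [set r | r = phi z]).
    by rewrite setIA (setIidl sA).
  - exists (~` (O `&` [set t | phi t <> phi z])).
      exact/open_closedC/(loc [set r | r <> phi z]).
    apply/seteqP; split=> t [At]; first by move=> e; split=> // -[].
    by move=> h; split=> //; apply: contrapT => ne; apply: h; split=> //; exact: sA.
by move=> /seteqP[_ /(_ _ Az')[]].
Qed.

End LocallyConstant.

Section Leaves.
Context (R : realType) (n q : nat) (M : manifold R n) (F : foliation M q).

Lemma smooth_at_leaf (f : M -> R) (l : leaf_index F) (z : leaf l) :
  smooth_at f (Defs.incl z) -> smooth_at (f \o Defs.incl (l:=l)) z.
Proof.
move=> sf c ac cz k; set i := Defs.incl (l:=l); set d := chart_at (i z).
have ad : atlas d by exact: atlas_chart_at.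
have dz : dom d (i z) by exact: dom_chart_at.
have [ci si] := incl_smooth l.
have oi : open (i @^-1` dom d).
  by apply: open_comp (dom_open d) => t _; exact: ci.
have oo : open (fwd c @` (dom c `&` i @^-1` dom d)).
  by rewrite setIC; exact: open_fwd.
have sic : forall k, Ck k (fwd d \o i \o bwd c) (fwd c z).
  by apply: ((smooth_onP _ oo).1 (si c d ac ad)); exists z.
apply: (@Ck_near _ _ _ k ((f \o bwd d) \o (fwd d \o i \o bwd c))).
  have := near_bwd cz (open_nbhs_nbhs (conj oi dz)).
  by apply: filterS => y dy; rewrite /= fwdK.
apply: Ck_comp => //; rewrite /= (fwdK cz); exact: sf.
Qed.

Lemma diff_leaf (l : leaf_index F) (z : leaf l) :
  differentiable (fwd (chart_at (Defs.incl z)) \o Defs.incl (l:=l) \o bwd (chart_at z))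
    (fwd (chart_at z) z).
Proof.
set c := chart_at z; set i := Defs.incl (l:=l); set d := chart_at (i z).
have ad : atlas d by exact: atlas_chart_at.
have ac : atlas c by exact: atlas_chart_at.
have dz : dom d (i z) by exact: dom_chart_at.
have cz : dom c z by exact: dom_chart_at.
have [ci si] := incl_smooth l.
have oi : open (i @^-1` dom d).
  by apply: open_comp (dom_open d) => t _; exact: ci.
have oo : open (fwd c @` (dom c `&` i @^-1` dom d)).
  by rewrite setIC; exact: open_fwd.
have : Ck 0 (fwd d \o i \o bwd c) (fwd c z).
  by apply: ((smooth_onP _ oo).1 (si c d ac ad)); exists z.
by move=> /Ck_diff/nbhs_singleton.
Qed.

Lemma dfun_leaf (f : M -> R) (l : leaf_index F) (z : leaf l) w :
  smooth_at f (Defs.incl z) ->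
  dfun (f \o Defs.incl (l:=l)) z w = dfun f (Defs.incl z) (tangent_map (Defs.incl (l:=l)) z w).
Proof.
move=> sf; set c := chart_at z; set i := Defs.incl (l:=l); set d := chart_at (i z).
have ad : atlas d by exact: atlas_chart_at.
have dz : dom d (i z) by exact: dom_chart_at.
have cz : dom c z by exact: dom_chart_at.
have [ci _] := incl_smooth l.
have oi : open (i @^-1` dom d).
  by apply: open_comp (dom_open d) => t _; exact: ci.
have e : \forall y \near fwd c z,
    ((f \o bwd d) \o (fwd d \o i \o bwd c)) y = (f \o i \o bwd c) y.
  have := near_bwd cz (open_nbhs_nbhs (conj oi dz)).
  by apply: filterS => y dy; rewrite /= fwdK.
have df := smooth_at_diff sf ad dz.
have ez : (fwd d \o i \o bwd c) (fwd c z) = fwd d (i z) by rewrite /= fwdK.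
rewrite -ez in df.
rewrite /dfun -/c -(near_eq_derive w e) (derive_comp _ (diff_leaf z) df).
by rewrite ez.
Qed.

Lemma vertical_tangent (l : leaf_index F) (z : leaf l) w :
  vertical F (Defs.incl z) (tangent_map (Defs.incl (l:=l)) z w).
Proof. by exists l, z, w. Qed.

Lemma verticalE (l : leaf_index F) (z : leaf l) v :
  vertical F (Defs.incl z) v -> exists w, v = tangent_map (Defs.incl (l:=l)) z w.
Proof.
move=> [l' [z' [w [e <-]]]].
have ll := leaf_disjoint e; subst l'.
by rewrite (incl_injective e); exists w.
Qed.

(** The rows of [T] are the images of the basis under the differential of the leaf inclusion,
    independent because it is an immersion. This is what makes the rank of [gT] constant. *)
Lemma vertical_dim x : exists T : 'M[R]_(n - q, n),
  row_free T /\ forall v, vertical F x v <-> (v <= T)%MS.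
Proof.
have [l [z <-]] := leaf_cover F x.
pose T : 'M[R]_(n - q, n) := \matrix_i tangent_map (Defs.incl (l:=l)) z (delta_mx 0 i).
have TE w : tangent_map (Defs.incl (l:=l)) z w = w *m T.
  rewrite /tangent_map (derive_rowE _ (diff_leaf z)) mulmx_sum_row.
  by apply: eq_bigr => i _; rewrite rowK.
exists T; split; last first.
  move=> v; split; first by move=> /verticalE[w ->]; rewrite TE submxMl.
  by move=> /submxP[w ->]; rewrite -TE; exact: vertical_tangent.
rewrite -kermx_eq0; apply/eqP/row_matrixP => i; rewrite row0.
apply: (incl_immersion (l:=l) (z:=z)).
by rewrite !TE mul0mx -row_mul mulmx_ker row0.
Qed.

Lemma basic_dfun0 (f : M -> R) : (forall x, smooth_at f x) -> basic_on F setT f ->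
  forall x v, vertical F x v -> dfun f x v = 0.
Proof.
move=> sf bf x v [l [z [w [<- <-]]]]; rewrite -dfun_leaf //.
rewrite /dfun; set g := _ \o _.
have -> : g = fun=> f (Defs.incl z); last exact: derive_cst.
apply/funext => y; rewrite /g /=; apply: bf => //.
by rewrite preimage_setT connected_component_id //; exact: leaf_connected.
Qed.

(** Pulled back to a leaf, [f] has zero differential on the preimage of [U], hence is constant on
    its components. It serves for the temporal function and, on arbitrary [U], for the functions
    [g(X, Y)] of the bundle-like condition. *)
Lemma flat_basic (U : set M) (f : M -> R) : open U ->
  (forall x, U x -> smooth_at f x) ->
  (forall x, U x -> forall v, vertical F x v -> dfun f x v = 0) ->
  basic_on F U f.
Proof.
move=> oU sf df l z z' Uz zz'.
have oi : open (Defs.incl (l:=l) @^-1` U).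
  by apply: open_comp oU => t _; have [ci _] := incl_smooth l; exact: ci.
apply: (@locally_constant_component _ _ _ (f \o Defs.incl (l:=l)) z z' oi _ zz').
move=> t Ut; apply: (flat_locally_constant oi) => //.
  by move=> s Us; apply: smooth_at_leaf; exact: sf.
move=> s Us w; rewrite dfun_leaf; last exact: sf.
by apply: df => //; exact: vertical_tangent.
Qed.

End Leaves.

(** * Widening the transverse cones *)

Section Widening.
Context (R : realType) (n : nat).
Implicit Types (G : 'M[R]_n) (D : 'cV[R]_n) (v w : 'rV[R]_n).

Definition widen G D : 'M[R]_n := G - D *m D^T.

Lemma widenE G D v w : bil (widen G D) v w = bil G v w - form D v * form D w.
Proof.
rewrite /widen bil_addmx; congr (_ + _).
rewrite /bil mulmxN mulNmx mxE; congr (- _).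
by rewrite mulmxA -mulmxA -trmx_mul mxE big_ord1 [X in _ * X]mxE.
Qed.

Lemma widen_sym G D : G^T = G -> (widen G D)^T = widen G D.
Proof. by move=> sG; rewrite /widen linearB /= trmx_mul trmxK sG. Qed.

Lemma timelike_causal G v : bil G v v < 0 -> causal G v.
Proof. by move=> qv; split; [move=> /(_ v) h; move: qv; rewrite h ltxx|exact: ltW]. Qed.

Lemma widen_timelike G D v : cone_form G D -> causal G v ->
  bil (widen G D) v v < 0.
Proof.
move=> [_ H2 _] cv; rewrite widenE -expr2.
have d0 : 0 < form D v ^+ 2 by rewrite exprn_even_gt0 //; apply/eqP; exact: H2.
by case: cv => _ qv; lra.
Qed.

Lemma widen_kernel G D : G^T = G -> has_index G 1 -> cone_form G D ->
  bil_kernel (widen G D) = bil_kernel G.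
Proof.
move=> sG iG cf; have [H1 H2 H3] := cf; apply/seteqP; split=> v kv; last first.
  by move=> w; rewrite widenE kv H3 // mul0r subr0.
have [t qt] := index1_timelike iG; have ct := timelike_causal qt.
have qt' := widen_timelike cf ct; have dt := H2 t ct.
have sW := widen_sym D sG.
have dv : form D v = 0.
  apply: contrapT => dv.
  (* This choice puts [v - a *: t] in the kernel of [D], where the widened form is nonnegative; but
     [v] is in the kernel of that form, so the square is [a ^+ 2] times a negative number. *)
  pose a := form D v / form D t.
  have a0 : a != 0 by rewrite mulf_neq0 ?invr_eq0; apply/eqP.
  have du : form D (v - a *: t) = 0.
    by rewrite formD formN formZ divfK ?subrr //; apply/eqP.
  have : 0 <= bil (widen G D) (v - a *: t) (v - a *: t).
    by rewrite widenE du mul0r subr0; exact: H1.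
  have -> : bil (widen G D) (v - a *: t) (v - a *: t) = a ^+ 2 * bil (widen G D) t t.
    rewrite !(bilDl, bilDr, bilNl, bilNr, bilZl, bilZr) (bilC t v sW) !kv; ring.
  rewrite leNgt => /negP; apply.
  by rewrite nmulr_llt0 // exprn_even_gt0.
by move=> w; have := kv w; rewrite widenE dv mul0r subr0.
Qed.

Lemma widen_cone_form G D : G^T = G -> has_index G 1 -> cone_form G D ->
  cone_form (widen G D) D.
Proof.
move=> sG iG cf; have [H1 H2 H3] := cf; split=> w.
- by move=> dw; rewrite widenE dw mul0r subr0; exact: H1.
- rewrite /causal /= widen_kernel // => -[kw]; rewrite widenE => + dw.
  by rewrite dw mul0r subr0 => qw; exact: (H2 w).
- by rewrite widen_kernel //; exact: H3.
Qed.

Lemma widen_index1 G D : has_index G 1 -> cone_form G D ->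
  has_index (widen G D) 1.
Proof.
move=> iG cf; have [t /timelike_causal ct] := index1_timelike iG.
apply: (has_index1 (D := D) (widen_timelike cf ct)) => w dw.
by rewrite widenE dw mul0r subr0; case: cf => + _ _; apply.
Qed.

End Widening.

(** * Monotonicity along piecewise smooth causal curves *)

Lemma lt_last_steps (R : realType) (phi : R -> R) (ts : seq R) a :
  (forall i, (i < size ts)%N -> phi (nth 0 (a :: ts) i) < phi (nth 0 ts i)) ->
  ts != [::] -> phi a < phi (last a ts).
Proof.
move=> h nt; suff : phi a <= phi (last a ts) /\
    (ts != [::] -> phi a < phi (last a ts)) by case=> _; apply.
elim: ts a h {nt} => [|t ts IH] a h; first by [].
have [h1 _] := IH t (fun i => h i.+1).
have h0 : phi a < phi t by exact: (h 0%N isT).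
by split=> [|_] /=; [apply: ltW|]; exact: lt_le_trans h0 h1.
Qed.

Section Curves.
Context (R : realType) (n : nat) (M : manifold R n).

Lemma increasing_along_curve (f : M -> R) (J : set R) (del : R -> M) s t :
  (forall x, smooth_at f x) -> open J -> smooth_curve J del -> s < t ->
  (forall u, s <= u <= t -> J u /\ 0 < dfun f (del u) (velocity del u)) ->
  f (del s) < f (del t).
Proof.
move=> sf oJ [cd sd] st h.
have D u : s <= u <= t ->
    is_derive u (1 : R) (f \o del) (dfun f (del u) (velocity del u)).
  move=> /h[Ju _]; set c := chart_at (del u).
  have ac : atlas c by exact: atlas_chart_at.
  have cu : dom c (del u) by exact: dom_chart_at.
  have dd : differentiable (fwd c \o del) u by apply: (sd c ac [::] u); split.
  have df := smooth_at_diff (sf (del u)) ac cu.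
  have n1 : \forall v \near u, dom c (del v) by exact: (cd u Ju) (near_dom cu).
  apply: (@near_eq_is_derive _ _ _ ((f \o bwd c) \o (fwd c \o del))).
    by apply: filterS n1 => v dv; rewrite /= fwdK.
  apply: DeriveDef; first exact/diff_derivable/differentiable_comp.
  by rewrite (derive_comp _ dd df) /velocity derive1E /dfun.
have cf : {within `[s, t], continuous (f \o del)}.
  apply: derivable_within_continuous => u; rewrite in_itv /= => uI.
  by case: (D u uI).
have [u|u uI e] := @MVT _ (f \o del)
    (fun u => dfun f (del u) (velocity del u)) s t st _ cf.
  by rewrite in_itv /= => /andP[su ut]; apply: D; rewrite !ltW.
have uI' : s <= u <= t by move: uI; rewrite in_itv /= => /andP[su ut]; rewrite !ltW.
rewrite -subr_gt0 [X in 0 < X]e mulr_gt0 ?subr_gt0 //.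
by have [] := h u uI'.
Qed.

Lemma increasing_future_causal (f : M -> R) (fut : M -> set 'rV[R]_n) a b gam :
  (forall x, smooth_at f x) -> (forall x v, fut x v -> 0 < dfun f x v) ->
  future_causal_curve fut a b gam -> f (gam a) < f (gam b).
Proof.
move=> sf hf [ab [ts [pts lts hts]]].
have tn : ts != [::] by apply: contraTneq ab => t0; rewrite -lts t0 /= ltxx.
rewrite -lts; apply: (@lt_last_steps _ (f \o gam)) => // i its.
have [J [del [oJ IJ sd hd]]] := hts i its.
have st : nth 0 (a :: ts) i < nth 0 ts i by exact: (pathP 0 pts).
set s := nth 0 (a :: ts) i in st hd IJ *; set t := nth 0 ts i in st hd IJ *.
have sI : s <= s <= t by rewrite lexx ltW.
have tI : s <= t <= t by rewrite lexx ltW.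
(* [gam] is known to agree with the smooth piece [del] only on the closed subinterval, so the
   endpoint values are transferred and [del] is differentiated instead. *)
rewrite /= (hd s sI).1 (hd t tI).1.
apply: (increasing_along_curve sf oJ sd st) => u uI.
by split; [exact: IJ|apply: hf; exact: (hd u uI).2].
Qed.

End Curves.

Lemma dfun_subM (R : realType) n (M : manifold R n) (A P Q : M -> R) x v :
  smooth_at A x -> smooth_at P x -> smooth_at Q x ->
  dfun (fun y => A y - P y * Q y) x v =
  dfun A x v - (P x * dfun Q x v + Q x * dfun P x v).
Proof.
move=> sA sP sQ; rewrite /dfun; set b := bwd _; set y := fwd _ x.
have d (f : M -> R) : smooth_at f x -> derivable (f \o b) y v.
  move=> sf; apply: diff_derivable; apply: smooth_at_diff => //.
  - exact: atlas_chart_at.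
  - exact: dom_chart_at.
have by_ : b y = x by apply: fwdK; exact: dom_chart_at.
have -> : (fun y => A y - P y * Q y) \o b = (A \o b) - (P \o b) * (Q \o b) by [].
rewrite (deriveB (d A sA) (derivableM (d P sP) (d Q sQ))).
by rewrite (deriveM (d P sP) (d Q sQ)) /= by_.
Qed.

(** * Stable causality from a transverse temporal function *)

Section Transverse.
Context (R : realType) (n q : nat) (M : manifold R n) (F : foliation M q).
Context (gT : M -> 'M[R]_n) (fut : M -> set 'rV[R]_n).
Context (hgT : transverse_lorentzian F gT).
Context (hfut : transverse_time_orientation F gT fut).

Lemma transverse_kernel x : bil_kernel (gT x) = vertical F x.
Proof. by have [_ /(_ x)[]] := hgT. Qed.

Lemma transverse_sym x : (gT x)^T = gT x.
Proof. by have [_ /(_ x)[]] := hgT. Qed.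

Lemma transverse_index x : has_index (gT x) 1.
Proof. by have [_ /(_ x)[]] := hgT. Qed.

Lemma transverse_smooth : smooth_tensor gT.
Proof. by have [] := hgT. Qed.

Lemma causalE x : transversely_causal_vec F gT x = causal (gT x).
Proof. by rewrite /transversely_causal_vec /causal transverse_kernel. Qed.

Lemma wedgeE x : exists2 v, causal (gT x) v &
  fut x = connected_component (causal (gT x)) v.
Proof. by have [/(_ x) + _] := hfut; rewrite causalE. Qed.

Section Temporal.
Context (f : M -> R).
Context (tf : transverse_temporal fut f).

Lemma temporal_smooth x : smooth_at f x.
Proof.
by have [sf _] := tf; apply: ((smooth_funP _ openT).1 sf).
Qed.

Lemma temporal_cone_form x : cone_form (gT x) (dcol f x).
Proof.
have [v cv E] := wedgeE x.
apply: (positive_cone_form (transverse_sym x) (transverse_index x) cv) => w.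
rewrite -E => fw; rewrite -dfunE; last exact: temporal_smooth.
by have [_] := tf; apply.
Qed.

Lemma temporal_wedge x :
  fut x = [set v | causal (gT x) v /\ 0 < form (dcol f x) v].
Proof.
have [v cv E] := wedgeE x; rewrite E.
apply: (cone_component (transverse_sym x) (temporal_cone_form x) cv).
rewrite -dfunE; last exact: temporal_smooth.
have [_] := tf; apply; rewrite E; exact: connected_component_refl.
Qed.

Lemma temporal_vertical x v : vertical F x v -> dfun f x v = 0.
Proof.
rewrite -transverse_kernel => kv; rewrite dfunE; last exact: temporal_smooth.
by have [_ _] := temporal_cone_form x; apply.
Qed.

Lemma temporal_basic : basic_on F setT f.
Proof.
apply: flat_basic => //; first exact: openT.
  by move=> x _; exact: temporal_smooth.
by move=> x _; exact: temporal_vertical.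
Qed.

Definition wide x := widen (gT x) (dcol f x).

(** Defined by the sign of [df], so that [f] increases along its curves by construction;
    [cone_component] identifies it with a connected component. *)
Definition wide_fut x : set 'rV[R]_n :=
  [set v | causal (wide x) v /\ 0 < form (dcol f x) v].

Lemma wideE x u v : bil (wide x) u v = bil (gT x) u v - dfun f x u * dfun f x v.
Proof. by rewrite widenE !dfunE //; exact: temporal_smooth. Qed.

Lemma wide_smooth : smooth_tensor wide.
Proof.
move=> c ac u v; have oc : open (fwd c @` dom c) by exact: img_open.
apply/(smooth_onP _ oc) => _ [x cx <-] k.
have G := (smooth_onP _ oc).1 (transverse_smooth ac u v).
have Gx : Ck k (fun y => bil (gT (bwd c y)) (of_chart c (bwd c y) u)
  (of_chart c (bwd c y) v)) (fwd c x) by apply: G; exists x.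
pose D (w : 'rV[R]_n) := 'D_w (f \o bwd c).
have CD w : Ck k (D w) (fwd c x).
  by have [_] := temporal_smooth ac cx k.+1; apply.
apply: Ck_near (CkD Gx (CkZ (-1) (CkM (CD u) (CD v)))).
have n1 := near_bwd cx (near_dom cx); have n2 := near_bwdK cx.
apply: filterS (filterI n1 n2) => y [dy e].
have E w : dfun f (bwd c y) (of_chart c (bwd c y) w) = D w y.
  by rewrite (dfun_of_chart w (temporal_smooth (x := bwd c y)) ac dy) e.
by rewrite wideE !E scaleN1r.
Qed.

(* Since [df] vanishes on vertical vectors, [df([V, X]) = V (df X)]. *)
Lemma wide_lie (U : set M) (V X Y : M -> 'rV[R]_n) x : open U ->
  vertical_vfield F U V -> smooth_vfield U X -> smooth_vfield U Y -> U x ->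
  lie_derivative V wide X Y x = 0.
Proof.
move=> oU vV sX sY Ux; have [_ _ /(_ U V X Y oU vV sX sY x Ux) L] := hgT.
have sf := temporal_smooth.
have [sV vv] := vV.
have sVx := (smooth_vfieldP V oU).1 sV x Ux.
have sXx := (smooth_vfieldP X oU).1 sX x Ux.
have sYx := (smooth_vfieldP Y oU).1 sY x Ux.
(* [df(V)] vanishes on all of [U], so its derivative at [x] is zero also in nonvertical
   directions. *)
have V0 Z : dfun (fun y => dfun f y (V y)) x Z = 0.
  rewrite (near_dfun (g := fun=> 0)); first exact: derive_cst.
  have := open_nbhs_nbhs (conj oU Ux).
  by apply: filterS => y Uy; apply: temporal_vertical; exact: vv.
have gen (p r s : R) : p = r - s -> s = 0 -> p = r by move=> -> ->; rewrite subr0.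
have BX : dfun f x (bracket V X x) = dfun (fun y => dfun f y (X y)) x (V x).
  exact: gen (dfun_bracket sf sVx sXx) (V0 (X x)).
have BY : dfun f x (bracket V Y x) = dfun (fun y => dfun f y (Y y)) x (V x).
  exact: gen (dfun_bracket sf sVx sYx) (V0 (Y x)).
have Leib : dfun (fun y => bil (wide y) (X y) (Y y)) x (V x) =
  dfun (fun y => bil (gT y) (X y) (Y y)) x (V x) -
  (dfun f x (X x) * dfun (fun y => dfun f y (Y y)) x (V x) +
   dfun f x (Y x) * dfun (fun y => dfun f y (X y)) x (V x)).
  have -> : (fun y => bil (wide y) (X y) (Y y)) =
      (fun y => bil (gT y) (X y) (Y y) - dfun f y (X y) * dfun f y (Y y)).
    by apply/funext => y; rewrite wideE.
  exact: (dfun_subM _ (smooth_at_bil transverse_smooth sXx sYx)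
    (smooth_at_dfun sf sXx) (smooth_at_dfun sf sYx)).
(* The Leibniz terms of the product of differentials cancel in pairs against the bracket terms,
   leaving the Lie derivative of [gT]. *)
have gen2 (A B C p r s t l b c i j : R) : l = A - (p * s + r * t) ->
    b = B - i * r -> i = t -> c = C - p * j -> j = s -> A - B - C = 0 ->
    l - b - c = 0.
  by move=> -> -> -> -> -> h; rewrite -[RHS]h; ring.
exact: gen2 Leib (wideE x (bracket V X x) (Y x)) BX
  (wideE x (X x) (bracket V Y x)) BY L.
Qed.

Lemma wide_transverse : transverse_lorentzian F wide.
Proof.
split; first exact: wide_smooth; last first.
  move=> U V X Y oU vV sX sY x Ux; exact: wide_lie vV sX sY Ux.
move=> x; have sG := transverse_sym x; have iG := transverse_index x.
have cf := temporal_cone_form x; split; first exact: widen_sym.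
- by rewrite widen_kernel // transverse_kernel.
- exact: widen_index1.
Qed.

(** The new wedges contain the old ones, so the local continuous fields that orient [gT] also orient
    the widened metric. *)
Lemma wide_orientation : transverse_time_orientation F wide wide_fut /\
  (forall x, fut x `<=` wide_fut x).
Proof.
have fw x : fut x `<=` wide_fut x.
  move=> v; rewrite temporal_wedge => -[cv dv]; split=> //.
  have qv := widen_timelike (temporal_cone_form x) cv.
  exact: timelike_causal.
split=> //; split=> x.
  have [v cv E] := wedgeE x.
  have vf : fut x v by rewrite E; exact: connected_component_refl.
  have [cw dw] := fw x v vf; exists v.
    by rewrite /transversely_causal_vec; case: cw => kw qw; split=> //;
      rewrite -transverse_kernel -(widen_kernel (D := dcol f x)
        (transverse_sym x) (transverse_index x) (temporal_cone_form x)).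
  have -> : transversely_causal_vec F wide x = causal (wide x).
    rewrite /transversely_causal_vec /causal -transverse_kernel.
    by rewrite (widen_kernel (transverse_sym x) (transverse_index x) (temporal_cone_form x)).
  rewrite (cone_component _ _ cw dw) //; first exact/widen_sym/transverse_sym.
  exact: widen_cone_form (transverse_sym x) (transverse_index x) (temporal_cone_form x).
have [_ /(_ x)[U [X [oU Ux cX fX]]]] := hfut.
by exists U, X; split=> // y Uy; apply: fw; exact: fX.
Qed.

Lemma wide_positive x v : wide_fut x v -> 0 < dfun f x v.
Proof. by move=> [_]; rewrite -dfunE //; exact: temporal_smooth. Qed.

Lemma wide_causal : transversely_causal F wide_fut.
Proof.
move=> l [a [b [gam [fc [z ez] [z' ez']]]]].
have := increasing_future_causal temporal_smooth wide_positive fc.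
rewrite -ez -ez'; have -> : f (Defs.incl z') = f (Defs.incl z).
  apply: temporal_basic => //.
  by rewrite preimage_setT connected_component_id //; exact: leaf_connected.
by rewrite ltxx.
Qed.

Lemma temporal_stably_causal : transversely_stably_causal F gT fut.
Proof.
have [h1 h2] := wide_orientation.
exists wide, wide_fut; split=> //; [exact: wide_transverse| |exact: wide_causal].
move=> x v nv qv; apply: widen_timelike (temporal_cone_form x) _.
by split=> //; rewrite transverse_kernel.
Qed.

End Temporal.
End Transverse.

(** * From a basic temporal function to a transverse one *)

Section BasicTemporal.
Context (R : realType) (n q : nat) (M : manifold R n) (F : foliation M q).
Context (gT : M -> 'M[R]_n) (fut : M -> set 'rV[R]_n).
Context (hgT : transverse_lorentzian F gT).
Context (hfut : transverse_time_orientation F gT fut).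

Lemma basic_temporal_transverse (g : M -> 'M[R]_n) (f : M -> R) :
  bundle_like F g -> associated F g gT -> temporal g fut f ->
  basic_on F setT f -> transverse_temporal fut f.
Proof.
move=> [[sg /= lg] dec _ _] ass [sf tg] bf; split=> // x w fw.
have sfx := (smooth_funP f openT).1 sf.
have [v [gv qv fv]] := tg x.
have vp : vertical_perp F g x v.
  move=> u vu; rewrite gv; apply: (basic_dfun0 _ bf vu) => y; exact: sfx.
have [u [w1 [vu pw1 ew]]] := dec x w.
have v0 : vertical F x 0 by rewrite -(transverse_kernel hgT) => z; exact: bil0l.
have pc : perp_component F g x w w1 by split; rewrite // ew addrK.
have pv : perp_component F g x v v by split; rewrite // subrr.
have gvw : dfun f x w = bil (gT x) v w.
  by rewrite -gv ew bilDr (vp u vu) add0r (ass x v v w w1 pv pc) -ew.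
have sG := transverse_sym hgT x; have iG := transverse_index hgT x.
have qT : bil (gT x) (- v) (- v) < 0.
  by rewrite bilNl bilNr opprK -(ass x v v v v pv pv).
(* The dual form of the timelike vector [- v] is [bil (gT x) v], whose value at [w] is [df(w)]. It
   is positive at [- v], hence on the component of [- v], which is [fut x]. *)
have cf := lorentz_cone_form sG iG qT.
have fE z : form (- gT x *m (- v)^T) z = bil (gT x) v z.
  rewrite /form mulNmx mulmxN mxE mulmxA -/(bil (gT x) z (- v)) bilNr opprK.
  exact: bilC.
have [v1 cv1 E] := wedgeE hgT hfut x.
have E2 : fut x = connected_component (causal (gT x)) (- v).
  by rewrite E; apply: same_connected_component; rewrite -E.
rewrite gvw -fE; case: cf => _ h _; apply: (form_sign_component h (v := - v)).
  by rewrite fE bilNr oppr_gt0; move: qT; rewrite bilNl bilNr opprK.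
by rewrite -E2.
Qed.

End BasicTemporal.

(** * Riemannian metrics *)

Section SquaredNorm.
Context (R : realType) (n : nat).

(** The norm on ['rV[R]_n] is the sup norm, not smooth in general; this Euclidean square is
    polynomial and suits bumps and local metrics. *)
Definition sqn (v : 'rV[R]_n) : R := bil 1%:M v v.

Lemma sqnE v : sqn v = \sum_i v 0 i ^+ 2.
Proof.
by rewrite /sqn /bil mulmx1 mxE; apply: eq_bigr => i _; rewrite mxE expr2.
Qed.

Lemma sqn_ge0 v : 0 <= sqn v.
Proof. by rewrite sqnE sumr_ge0 // => i _; exact: sqr_ge0. Qed.

Lemma sqn_eq0 v : sqn v = 0 -> v = 0.
Proof.
move=> h; apply/rowP => i; rewrite mxE; apply/eqP; rewrite -sqrf_eq0.
move: h; rewrite sqnE => /psumr_eq0P/(_ i isT) -> // j _; exact: sqr_ge0.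
Qed.

Lemma norm_le_sqn v r : 0 <= r -> sqn v <= r ^+ 2 -> `|v| <= r.
Proof.
move=> r0 h; rewrite [leLHS]/Num.norm /= mx_normrE; apply: bigmax_le => // -[i j] _.
rewrite ord1 /= -(ler_pXn2r (n := 2)) ?nnegrE // real_normK ?num_real //.
apply: le_trans h; rewrite sqnE (bigD1 j) //= lerDl sumr_ge0 // => k _.
exact: sqr_ge0.
Qed.

Lemma Ck_sqn k (V : normedModType R) (u : V -> 'rV[R]_n) x :
  Ck k u x -> Ck k (fun y => sqn (u y)) x.
Proof. by move=> hu; apply: Ck_bil => //; exact: Ckmx_cst. Qed.

Lemma sqn_closed_compact (y0 : 'rV[R]_n) (r : R) : 0 <= r ->
  compact [set y | sqn (y - y0) <= r ^+ 2].
Proof.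
move=> r0; apply: bounded_closed_compact.
  exists (`|y0| + r); split; first exact: num_real.
  move=> a ra y hy; apply: le_trans (ltW ra).
  rewrite -(subrK y0 y) addrC; apply: le_trans (ler_normD _ _) _.
  by rewrite lerD2l norm_le_sqn.
rewrite -[X in closed X]/((fun y => sqn (y - y0)) @^-1` [set t | t <= r ^+ 2]).
apply: preimage_closed; last exact: closed_le.
  move=> y _; apply: differentiable_continuous.
  have := @Ck_sqn 0 _ (fun y => y - y0) y (CkD (Ck_id _ _) (Ck_cst _ _ _)).
  by move=> /Ck_diff/nbhs_singleton.

Qed.

End SquaredNorm.

(** * Bump functions and local metrics *)

Section LocalPieces.
Context (R : realType) (n : nat) (M : manifold R n).

(** [phi] vanishes off the image of a compact coordinate ball, which is closed because [M] is
    Hausdorff, so the extension by zero is smooth. The last clause lets tensors that make sense only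
    in the chart be extended too. *)
Lemma chart_bump (p : M) : exists phi : M -> R,
  [/\ forall x, smooth_at phi x, forall x, 0 <= phi x, 0 < phi p,
      forall x, 0 < phi x -> dom (chart_at p) x &
      forall x, ~ dom (chart_at p) x -> \forall z \near x, phi z = 0].
Proof.
set c := chart_at p; have ac : atlas c by exact: atlas_chart_at.
have cp : dom c p by exact: dom_chart_at.
set y0 := fwd c p.
have : nbhs y0 (fwd c @` dom c).
  by apply: open_nbhs_nbhs; split; [exact: img_open|exists p].
move=> /nbhs_ballP[r /= r0 br].
(* The closed Euclidean ball of radius [s] then lies in the open sup-norm ball of radius [r], inside
   the chart image. *)
pose s := r / 2; have s0 : 0 < s by rewrite divr_gt0.
pose phi x := if `[< dom c x >] then flat_exp 0 (s ^+ 2 - sqn (fwd c x - y0)) else 0.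
pose K0 := [set y | sqn (y - y0) <= s ^+ 2].
have K0r : K0 `<=` fwd c @` dom c.
  move=> y hy; apply: br; rewrite -ball_normE /= distrC.
  apply: (@le_lt_trans _ _ s); first by apply: norm_le_sqn hy; exact: ltW.
  by rewrite /s ltr_pdivrMr // ltr_pMr // ltr1n.
pose K := bwd c @` K0.
have cK : closed K.
  apply: compact_closed; first exact: manifold_hausdorff.
  apply: continuous_compact; last exact/sqn_closed_compact/ltW.
  apply: continuous_in_subspaceT => y; rewrite inE => /K0r[x cx <-].
  exact: bwd_continuous.
have out x : ~ K x -> phi x = 0.
  move=> nK; rewrite /phi; case: asboolP => // cx; apply: flat_exp_le0.
  rewrite subr_le0 leNgt; apply/negP => h; apply: nK.
  by exists (fwd c x); [exact: ltW|rewrite fwdK].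
have near0 x : ~ dom c x -> \forall z \near x, phi z = 0.
  move=> nx; have nK : ~ K x.
    by move=> [y /K0r[z dz <-]]; rewrite fwdK // => zx; apply: nx; rewrite -zx.
  have oK : open (~` K) by rewrite openC.
  by apply: filterS (open_nbhs_nbhs (conj oK nK)) => z /out.
exists phi; split=> //.
- move=> x d ad dx k; have [cx|ncx] := pselect (dom c x); last first.
    apply: (@Ck_near _ _ _ k (fun=> 0)); last exact: Ck_cst.
    by apply: filterS (near_bwd dx (near0 x ncx)) => y /= ->.
  apply: (@Ck_near _ _ _ k (flat_exp 0 \o (fun y => s ^+ 2 + (-1) *: sqn (trans d c y - y0)))).
    apply: filterS (near_bwd dx (near_dom cx)) => y cy.
    by rewrite /= /phi asboolT // scaleN1r.
  apply: Ck_comp1; last exact: Ck_flat_exp.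
  apply: CkD; first exact: Ck_cst.
  apply/CkZ/Ck_sqn/CkD; [exact: Ck_trans|exact: Ck_cst].
- by move=> x; rewrite /phi; case: ifP => // _; exact: flat_exp_ge0.
- rewrite /phi asboolT // -/y0 subrr flat_exp_gt0.
  by rewrite /sqn bil0l subr0 exprn_gt0.
- by move=> x; rewrite /phi; case: asboolP => // _; rewrite ltxx.
Qed.

(** [t] is [phi] times the pullback of the Euclidean metric of the chart; off the chart the Jacobian
    is meaningless, but [phi] vanishes nearby. *)
Lemma local_piece (p : M) : exists (phi : M -> R) (t : M -> 'M[R]_n),
  [/\ forall x, smooth_at phi x, forall x, 0 <= phi x, 0 < phi p,
      smooth_tensor t & forall x, [/\ (t x)^T = t x,
        forall v, 0 <= bil (t x) v v &
        forall v, 0 < phi x -> v != 0 -> 0 < bil (t x) v v]].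
Proof.
have [phi [sphi phi0 phip phid near0]] := chart_bump p.
set c := chart_at p in phid near0; have ac : atlas c by exact: atlas_chart_at.
pose J x := Jac (chart_at x) c x.
have bE x v : bil (phi x *: (J x *m (J x)^T)) v v = phi x * sqn (v *m J x).
  rewrite /sqn bil_mull mulmx1 /bil -scalemxAr -scalemxAl mxE //.
exists phi, (fun x => phi x *: (J x *m (J x)^T)); split=> //; last first.
  move=> x; split.
  - by rewrite [LHS]linearZ /= trmx_mul trmxK.
  - by move=> v; rewrite bE mulr_ge0 // sqn_ge0.
  - move=> v px v0; rewrite bE mulr_gt0 // lt0r sqn_ge0 andbT.
    apply: contra_neq v0 => /sqn_eq0 h.
    have cx := phid x px.
    rewrite -[v]mulmx1 -(JacK (atlas_chart_at x) ac (dom_chart_at x) cx).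
    by rewrite mulmxA -/(J x) h mul0mx.
apply/smooth_tensorP => d x ad dx k.
have E y : dom d (bwd d y) -> dom c (bwd d y) ->
   trep d (fun x => phi x *: (J x *m (J x)^T)) y =
   phi (bwd d y) *: (Jac d c (bwd d y) *m (Jac d c (bwd d y))^T).
  move=> dy cy; rewrite /trep /= -scalemxAr -scalemxAl; congr (_ *: _).
  rewrite -(Jac_comp ad (atlas_chart_at (bwd d y)) ac dy (dom_chart_at _) cy).
  by rewrite trmx_mul !mulmxA.
have [cx|ncx] := pselect (dom c x) => i j.
  apply: (@Ck_near _ _ _ k (fun y => phi (bwd d y) *
    (Jac d c (bwd d y) *m (Jac d c (bwd d y))^T) i j)).
    apply: filterS (filterI (near_bwd dx (near_dom dx)) (near_bwd dx (near_dom cx))).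
    by move=> y [dy cy]; rewrite E // [RHS]mxE.
  apply: CkM; first exact: sphi.
  by apply: Ckmx_mul; [exact: Ck_Jac|apply: Ckmx_tr; exact: Ck_Jac].
apply: (@Ck_near _ _ _ k (fun=> 0)); last exact: Ck_cst.
apply: filterS (near_bwd dx (near0 x ncx)) => y e.
by rewrite /trep /= e scale0r mulmx0 mul0mx mxE.
Qed.

Lemma sum_stable (V : zmodType) (u : nat -> V) N N' :
  (forall k, (N <= k)%N -> u k = 0) -> (forall k, (N' <= k)%N -> u k = 0) ->
  \sum_(0 <= k < N) u k = \sum_(0 <= k < N') u k.
Proof.
wlog le : N N' / (N <= N')%N.
  by move=> h; case/orP: (leq_total N N') => [/h|/h + hN hN']; [exact|]; move/(_ hN' hN).
move=> hN _; rewrite [RHS](big_cat_nat (leq0n N) le) //= [X in _ + X]big1_seq ?addr0 //.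
by move=> k /andP[_]; rewrite mem_index_iota => /andP[/hN].
Qed.

End LocalPieces.

(** * A Riemannian metric from countably many local pieces *)

Section Gluing.
Context (R : realType) (n : nat) (M : manifold R n).

Definition nonneg_piece (phi : M -> R) (t : M -> 'M[R]_n) :=
  [/\ forall x, smooth_at phi x, forall x, 0 <= phi x,
      smooth_tensor t & forall x, [/\ (t x)^T = t x,
        forall v, 0 <= bil (t x) v v &
        forall v, 0 < phi x -> v != 0 -> 0 < bil (t x) v v]].

Lemma smooth_at_continuous (f : M -> R) x : smooth_at f x -> {for x, continuous f}.
Proof.
move=> sf; set c := chart_at x.
have ac : atlas c by exact: atlas_chart_at.
have cx : dom c x by exact: dom_chart_at.
have df := differentiable_continuous (smooth_at_diff sf ac cx).
move=> A; rewrite -{1}(fwdK cx) => nA.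
have n1 := near_fwd cx (df A nA).
by apply: filterS (filterI n1 (near_dom cx)) => z [] /= + dz; rewrite fwdK.
Qed.

(** Pieces are numbered by a countable base through [iota]: a base set on which some piece is
    positive keeps one such piece, and the other indices get the zero piece. Each [x] has a base
    neighbourhood of the first kind. *)
Lemma countable_pieces : exists (phi : nat -> M -> R) (t : nat -> M -> 'M[R]_n),
  (forall k, nonneg_piece (phi k) (t k)) /\ forall x, exists k, 0 < phi k x.
Proof.
have [B cB [oB bB]] := manifold_second_countable M.
have /countable_injP[iota inj] := cB.
have /choice[P hP] : forall p : M, exists u : (M -> R) * (M -> 'M[R]_n),
    nonneg_piece u.1 u.2 /\ 0 < u.1 p.
  by move=> p; have [phi [t [h1 h2 h3 h4 h5]]] := local_piece p; exists (phi, t).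
have /choice[Q hQ] : forall k, exists u : (M -> R) * (M -> 'M[R]_n),
    nonneg_piece u.1 u.2 /\
    forall b p, B b -> iota b = k -> b `<=` [set x | 0 < (P p).1 x] ->
      b `<=` [set x | 0 < u.1 x].
  move=> k.
  have [[b [p [Bb ib bp]]]|no] := pselect (exists b p,
      [/\ B b, iota b = k & b `<=` [set x | 0 < (P p).1 x]]).
    exists (P p); split; first by have [] := hP p.
    move=> b' p' Bb' ib' _; suff -> : b' = b by [].
    by apply: inj; rewrite ?inE // ib ib'.
  exists (fun=> 0, fun=> 0); split; last first.
    by move=> b p Bb ib bp; case: no; exists b, p.
  split=> //=.
  - by move=> x c ac cx k'; exact: Ck_cst.
  - apply/smooth_tensorP => c x ac cx k' i j.
    apply: (@Ck_near _ _ _ k' (fun=> 0)); last exact: Ck_cst.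
    by near=> y; rewrite /trep /= mulmx0 mul0mx mxE.
  - move=> x; split; first by rewrite trmx0.
    + by move=> v; rewrite /bil mulmx0 mul0mx mxE.
    + by move=> v; rewrite ltxx.
exists (fun k => (Q k).1), (fun k => (Q k).2); split.
  by move=> k; have [] := hQ k.
move=> x; have [[sx _ _ _] px] := hP x.
have cx := smooth_at_continuous (sx x).
have nx : nbhs x [set z | 0 < (P x).1 z] by exact: (cvgr_gt _ cx).
have [b [Bb bx] bP] := bB x _ nx.
by exists (iota b); have [_ /(_ b x Bb erefl bP)] := hQ (iota b); apply.
Unshelve. all: by end_near. Qed.

(* If [phi m x > 0], then [k.+1%:R^-1 - phi m] is negative near [x] for all
   large [k], where the factor with [j = m] vanishes: the family [weight phi] is
   locally finite.  At [x] it is positive for the least [k] with [phi k x > 0]. *)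
Definition weight (phi : nat -> M -> R) (k : nat) (x : M) : R :=
  \prod_(j < k) flat_exp 0 (k.+1%:R^-1 - phi j x).

Lemma riemannian_metric : exists h : M -> 'M[R]_n, smooth_tensor h /\
  forall x, posdef (h x).
Proof.
have [phi [t [np pos]]] := countable_pieces.
pose w := weight phi.
have w0 k x : 0 <= w k x by apply: prodr_ge0 => j _; exact: flat_exp_ge0.
have sw k x : smooth_at (w k) x.
  move=> c ac cx k'; rewrite (_ : w k \o bwd c = fun y =>
     \prod_(j < k) (flat_exp 0 \o (fun z => k.+1%:R^-1 + (-1) *: (phi j \o bwd c) z)) y).
    apply: Ck_prod => j _; apply: Ck_comp1; last exact: Ck_flat_exp.
    apply: CkD; first exact: Ck_cst.
    by apply: CkZ; have [/(_ x) + _ _ _] := np j; apply.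
  by apply/funext => y; apply: eq_bigr => j _; rewrite /= scaleN1r.
have fin (x : M) : exists N, \forall z \near x, forall k, (N <= k)%N -> w k z = 0.
  have [m pm] := pos x; pose a := phi m x.
  have a2 : 0 < a / 2 by rewrite divr_gt0.
  (* For such [k] the factor [j = m] occurs in the product, and [k.+1%:R^-1 <= a / 2] lies below
     [phi m] near [x]. *)
  exists (maxn m.+1 (Num.bound (a / 2)^-1)).
  have cx : {for x, continuous (phi m)}.
    by apply: smooth_at_continuous; have [/(_ x)] := np m.
  have n1 : \forall z \near x, a / 2 < phi m z.
    by apply: (cvgr_gt _ cx); rewrite ltr_pdivrMr // ltr_pMr // ltr1n.
  apply: filterS n1 => z az k; rewrite geq_max => /andP[mk bk].
  rewrite /w /weight (bigD1 (Ordinal mk)) //= flat_exp_le0 ?mul0r //.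
  rewrite subr_le0; apply: le_trans (ltW az).
  rewrite -[leRHS]invrK lef_pV2 ?posrE ?invr_gt0 ?ltr0n //.
  have := archi_boundP (ltW (_ : 0 < (a / 2)^-1)); rewrite invr_gt0 => /(_ a2) /ltW h.
  by apply: le_trans h _; rewrite ler_nat (leq_trans bk).
have /choice[N hN] := fin.
have vN x k : (N x <= k)%N -> w k x = 0 by exact: nbhs_singleton (hN x) k.
(* The bound [N x] may jump with [x], but near [x] all terms past that fixed bound vanish, so
   locally this is one finite sum. *)
pose h x := \sum_(0 <= k < N x) w k x *: t k x.
exists h; split.
  apply/smooth_tensorP => c x ac cx k' i j.
  apply: (@Ck_near _ _ _ k' (fun y =>
      \sum_(0 <= k < N x) (w k \o bwd c) y * trep c (t k) y i j)).
    apply: filterS (near_bwd cx (hN x)) => y hy.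
    rewrite /trep /= /h (@sum_stable _ _ (N (bwd c y)) (N x)).
    - rewrite mulmx_sumr mulmx_suml summxE; apply: eq_bigr => k _.
      by rewrite -scalemxAr -scalemxAl [RHS]mxE.
    - by move=> k /vN ->; rewrite scale0r.
    - by move=> k /hy ->; rewrite scale0r.
  apply: Ck_sum => k _; apply: CkM; first exact: sw.
  by have [_ _ /smooth_tensorP + _] := np k; apply.
move=> x; split.
  rewrite /h raddf_sum; apply: eq_bigr => k _.
  by have [_ _ _ /(_ x)[st _ _]] := np k; rewrite [LHS]linearZ /= st.
move=> v v0; have [m pm mmin] := ex_minnP (pos x).
have wm : 0 < w m x.
  apply: prodr_gt0 => j _; rewrite flat_exp_gt0.
  have -> : phi j x = 0.
    apply: le_anti; have [_ -> _ _] := np j; rewrite andbT leNgt.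
    by apply/negP => /mmin; rewrite leqNgt ltn_ord.
  by rewrite subr0 invr_gt0 ltr0n.
have mN : (m < N x)%N.
  by rewrite ltnNge; apply/negP => /vN e; rewrite e ltxx in wm.
rewrite /h bil_sum big_mkord (bigD1 (Ordinal mN)) //= bil_scale.
have tp k : 0 <= bil (t k x) v v by have [_ _ _ /(_ x)[_ + _]] := np k; apply.
rewrite ltr_pwDl //.
  by rewrite mulr_gt0 //; have [_ _ _ /(_ x)[_ _ +]] := np m; apply.
by apply: sumr_ge0 => k _; rewrite bil_scale mulr_ge0.
Qed.

End Gluing.

(** * Bundle-like metrics *)

Section KernelProjection.
Context (R : realType) (n : nat).
Implicit Types (G H P : 'M[R]_n) (v w : 'rV[R]_n).

Definition kernel_projection G H P := forall v,
  [/\ bil_kernel G (v *m P), bil_kernel G v -> v *m P = v &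
      forall w, bil_kernel G w -> bil H (v - v *m P) w = 0].

Lemma posdef_eq0 H v : posdef H -> bil H v v = 0 -> v = 0.
Proof.
by move=> [_ hp] h; apply/eqP/negPn/negP => /hp; rewrite h ltxx.
Qed.

Lemma posdef_ge0 H v : posdef H -> 0 <= bil H v v.
Proof.
by move=> [_ hp]; have [->|/hp/ltW//] := eqVneq v 0; rewrite bil0l.
Qed.

Lemma bil_kerD G v w : bil_kernel G v -> bil_kernel G w -> bil_kernel G (v - w).
Proof. by move=> hv hw u; rewrite bilDl bilNl hv hw subr0. Qed.

(** The difference of the two images of [v] lies in the kernel of [G] and is [H]-orthogonal to that
    kernel, hence to itself. *)
Lemma kernel_projection_unique G H P P' : posdef H ->
  kernel_projection G H P -> kernel_projection G H P' -> P = P'.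
Proof.
move=> pH hP hP'; apply: row_mulmx_inj => v.
have [k1 _ o1] := hP v; have [k2 _ o2] := hP' v.
have kd := bil_kerD k1 k2.
apply/eqP; rewrite -subr_eq0; apply/eqP; apply: (posdef_eq0 pH).
have -> : bil H (v *m P - v *m P') (v *m P - v *m P') =
    bil H (v - v *m P') (v *m P - v *m P') - bil H (v - v *m P) (v *m P - v *m P').
  by rewrite -bilNl -bilDl; congr (bil _ _ _); rewrite opprB [RHS]addrC addrA subrK.
by rewrite (o1 _ kd) (o2 _ kd) subr0.
Qed.

Definition gram r (S : 'M[R]_(r, n)) H := S *m invmx H *m S^T.

(** The rows of [S] are covectors whose common kernel is the target. The rows of [S *m invmx H] span
    its [H]-orthogonal complement and have Gram matrix [gram S H]; the subtracted term projects onto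
    that complement. *)
Definition proj_formula r (S : 'M[R]_(r, n)) H : 'M[R]_n :=
  1%:M - S^T *m invmx (gram S H) *m S *m invmx H.

Lemma unit_of_ker m (A : 'M[R]_m) :
  (forall v : 'rV_m, v *m A = 0 -> v = 0) -> A \in unitmx.
Proof.
move=> h; rewrite -row_free_unit -kermx_eq0; apply/eqP/row_matrixP => i.
by rewrite row0; apply: h; rewrite -row_mul mulmx_ker row0.
Qed.

Lemma posdef_unit H : posdef H -> H \in unitmx.
Proof.
move=> pH; apply: unit_of_ker => v vH; apply: (posdef_eq0 pH).
by rewrite /bil vH mul0mx mxE.
Qed.

Lemma gram_unit r (S : 'M[R]_(r, n)) H : posdef H -> row_free S ->
  gram S H \in unitmx.
Proof.
move=> pH fS; have uH := posdef_unit pH; apply: unit_of_ker => z hz.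
have : z *m S *m invmx H = 0.
  apply: (posdef_eq0 pH); have [sH _] := pH.
  rewrite /bil !trmx_mul trmx_inv sH -(mulmxA (z *m S)) mulVmx // mulmx1.
  have -> : z *m S *m (invmx H *m (S^T *m z^T)) = z *m gram S H *m z^T.
    by rewrite /gram !mulmxA.
  by rewrite hz mul0mx mxE.
move=> /(congr1 (mulmx^~ H)); rewrite -mulmxA mulVmx // mulmx1 mul0mx.
have [B SB] := row_freeP fS.
by move=> /(congr1 (mulmx^~ B)); rewrite -mulmxA SB mulmx1 mul0mx.
Qed.

Lemma proj_formulaP r (S : 'M[R]_(r, n)) G H : posdef H -> row_free S ->
  (forall v, bil_kernel G v <-> v *m S^T = 0) ->
  kernel_projection G H (proj_formula S H).
Proof.
move=> pH fS kS v; have uH := posdef_unit pH; have uW := gram_unit pH fS.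
have E w : w *m proj_formula S H =
    w - w *m S^T *m invmx (gram S H) *m S *m invmx H.
  by rewrite /proj_formula mulmxDr mulmx1 mulmxN !mulmxA.
split.
- apply/kS; rewrite E mulmxDl mulNmx -!mulmxA [S *m _]mulmxA -/(gram S H).
  by rewrite mulVmx // mulmx1 subrr.
- by move=> /kS h; rewrite E h !mul0mx subr0.
- move=> w /kS h; rewrite E opprB addrC subrK /bil.
  rewrite -(mulmxA _ (invmx H) H) mulVmx // mulmx1 -mulmxA.
  rewrite (_ : S *m w^T = 0) ?mulmx0 ?mxE //.
  by rewrite -[S]trmxK -trmx_mul h trmx0.
Qed.

Lemma kernel_row_space r (S : 'M[R]_(r, n)) G : G^T = G -> (S :=: G)%MS ->
  forall v, bil_kernel G v <-> v *m S^T = 0.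
Proof.
move=> sG SG v; rewrite bil_kerP; split=> h.
  have /submxP[Y ->] : (S <= G)%MS by rewrite SG.
  by rewrite trmx_mul sG mulmxA h mul0mx.
have /submxP[X e] : (G <= S)%MS by rewrite SG.
by rewrite -sG e trmx_mul mulmxA h mul0mx.
Qed.

Lemma kernel_projection_exists G H : G^T = G -> posdef H ->
  kernel_projection G H (proj_formula (row_base G) H).
Proof.
move=> sG pH; apply: proj_formulaP => //; first exact: row_base_free.
by apply: kernel_row_space => //; exact: eq_row_base.
Qed.

Lemma kernel_projection_change G H P J J' : J *m J' = 1%:M -> J' *m J = 1%:M ->
  kernel_projection G H P ->
  kernel_projection (J *m G *m J^T) (J *m H *m J^T) (J *m P *m J').
Proof.
move=> JJ JJ' hP v.
have K w : bil_kernel (J *m G *m J^T) w <-> bil_kernel G (w *m J).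
  split=> h u; last by rewrite -bil_mull.
  by have := h (u *m J'); rewrite -bil_mull -mulmxA JJ' mulmx1.
have [k1 k2 k3] := hP (v *m J).
have e : v *m (J *m P *m J') *m J = v *m J *m P.
  by rewrite !mulmxA -mulmxA JJ' mulmx1.
split.
- by apply/K; rewrite e.
- by move=> /K/k2 h; rewrite !mulmxA h -mulmxA JJ mulmx1.
- by move=> w /K kw; rewrite -bil_mull mulmxBl e; exact: k3.
Qed.

Lemma posdef_change H (J J' : 'M[R]_n) : J *m J' = 1%:M -> posdef H -> posdef (J *m H *m J^T).
Proof.
move=> JJ [sH pH]; split; first by rewrite !trmx_mul trmxK sH mulmxA.
move=> v v0; rewrite -bil_mull; apply: pH; apply: contra_neq v0 => h.
by rewrite -[v]mulmx1 -JJ mulmxA h mul0mx.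
Qed.

End KernelProjection.

(** * Smoothness of the vertical projection *)

Section SmoothProjection.
Context (R : realType) (n q : nat) (M : manifold R n) (F : foliation M q).
Context (gT : M -> 'M[R]_n).
Context (hgT : transverse_lorentzian F gT).
Context (h : M -> 'M[R]_n).
Context (sh : smooth_tensor h).
Context (ph : forall x, posdef (h x)).

Definition vproj x := proj_formula (row_base (gT x)) (h x).

Lemma vprojP x : kernel_projection (gT x) (h x) (vproj x).
Proof. exact: kernel_projection_exists (transverse_sym hgT x) (ph x). Qed.

(** The kernel is the vertical space, of dimension [n - q] with truncated subtraction. Later steps
    use that the value is the same at every [x]. *)
Lemma transverse_rank x : \rank (gT x) = (n - (n - q))%N.
Proof.
have [T [fT vT]] := vertical_dim F x.
have : (kermx (gT x) == T)%MS.
  apply/andP; split; apply/rV_subP => v.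
    by move=> /sub_kermxP kv; apply/vT; rewrite -(transverse_kernel hgT); apply/bil_kerP.
  by move=> /vT; rewrite -(transverse_kernel hgT) => /bil_kerP/sub_kermxP.
move=> /eqmx_rank; rewrite mxrank_ker (eqP fT).
have := rank_leq_row (gT x); set a := \rank _; lia.
Qed.

Definition vproj_rep (c : chart R n M) y : 'M[R]_n :=
  let x := bwd c y in
  Jac c (chart_at x) x *m vproj x *m Jac (chart_at x) c x.

Lemma vproj_repP c x : atlas c -> dom c x ->
  kernel_projection (trep c gT (fwd c x)) (trep c h (fwd c x))
    (vproj_rep c (fwd c x)).
Proof.
move=> ac cx; rewrite /trep /vproj_rep fwdK //=.
by apply: kernel_projection_change; rewrite ?JacK //;
  [exact: atlas_chart_at|exact: dom_chart_at|exact: atlas_chart_at|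
   exact: dom_chart_at|exact: vprojP].
Qed.

Lemma trep_posdef c x : atlas c -> dom c x -> posdef (trep c h (fwd c x)).
Proof.
move=> ac cx; rewrite /trep fwdK //=.
by apply: (posdef_change (J' := Jac (chart_at x) c x)); rewrite ?JacK //;
  [exact: atlas_chart_at|exact: dom_chart_at].
Qed.

Lemma trep_sym c x : (trep c gT (fwd c x))^T = trep c gT (fwd c x).
Proof. by rewrite /trep !trmx_mul trmxK (transverse_sym hgT) mulmxA. Qed.

Lemma trep_rank c x : atlas c -> dom c x ->
  \rank (trep c gT (fwd c x)) = (n - (n - q))%N.
Proof.
move=> ac cx; rewrite /trep fwdK //=; set J := Jac _ _ _.
have uJ : J \in unitmx.
  have [] // := mulmx1_unit (JacK ac (atlas_chart_at x) cx (dom_chart_at x)).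
rewrite mxrankMfree ?row_free_unit ?unitmx_tr //.
by rewrite (eqmxMfull _ (_ : row_full J)) ?row_full_unit // transverse_rank.
Qed.

Lemma vproj_smooth c x k : atlas c -> dom c x ->
  Ckmx k (fwd c x) (vproj_rep c).
Proof.
(* The rank of [gT] is constant, so near [y0] fixed linear combinations of its
   rows form a basis of its row space. *)
move=> ac cx; set y0 := fwd c x.
have sA := (smooth_tensorP gT).1 (transverse_smooth hgT).
have sH := (smooth_tensorP h).1 sh.
set A := trep c gT; set H := trep c h.
have /submxP[C eC] : (row_base (A y0) <= A y0)%MS by rewrite eq_row_base.
pose S y := C *m A y.
have fS0 : row_free (S y0) by rewrite /S -eC row_base_free.
have [B SB] := row_freeP fS0.
have CS k' : Ckmx k' y0 S by apply: Ckmx_mul; [exact: Ckmx_cst|exact: sA].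
(* [B] is a right inverse of [S y0], so the determinant is 1 at [y0]; where it is nonzero, the rows
   of [S y] stay independent. *)
have n0 : \forall y \near y0, \det (S y *m B) != 0.
  have Cd : Ck 0 (fun y => \det (S y *m B)) y0.
    by apply: Ck_det; apply: Ckmx_mul; [exact: CS|exact: Ckmx_cst].
  have d0 : \det (S y0 *m B) != 0 by rewrite SB det1 oner_eq0.
  have cd := @differentiable_continuous _ _ _ y0 (fun y => \det (S y *m B))
    (nbhs_singleton (Ck_diff Cd)).
  exact: (cvgr_neq0 _ cd d0).
have E : \forall y \near y0, proj_formula (S y) (H y) = vproj_rep c y.
  have n1 := near_bwd cx (near_dom cx); have n2 := near_bwdK cx.
  apply: filterS (filterI n0 (filterI n1 n2)) => y [dy [cy ey]].
  have fS : row_free (S y).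
    apply/row_freeP; exists (B *m invmx (S y *m B)).
    by rewrite mulmxA mulmxV // unitmxE unitfE.
  have SA : (S y :=: A y)%MS.
    have le : (S y <= A y)%MS by exact: submxMl.
    apply/eqmxP; rewrite -(geq_leqif (mxrank_leqif_eq le)) (eqP fS).
    by rewrite -{1}ey /A (trep_rank ac cy) (trep_rank ac cx).
  have pH : posdef (H y) by rewrite -ey; exact: trep_posdef.
  have sAy : (A y)^T = A y by rewrite -ey; exact: trep_sym.
  apply: (kernel_projection_unique pH (G := A y)).
    exact: proj_formulaP pH fS (kernel_row_space sAy SA).
  by rewrite -ey; exact: vproj_repP.
have pH0 : posdef (H y0) by exact: trep_posdef.
have CH : Ckmx k y0 (fun y => invmx (H y)).
  by apply: Ckmx_inv; [exact: posdef_unit|exact: sH].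
move=> i j; apply: (@Ck_near _ _ _ k (fun y => proj_formula (S y) (H y) i j)).
  by apply: filterS E => y ->.
move: i j; apply: CkmxD; first exact: Ckmx_cst.
apply: CkmxN; apply: Ckmx_mul => //; apply: Ckmx_mul; last exact: CS.
apply: Ckmx_mul; first by apply: Ckmx_tr; exact: CS.
apply: Ckmx_inv; first exact: gram_unit.
by apply: Ckmx_mul; [apply: Ckmx_mul|apply: Ckmx_tr]; rewrite //; exact: CS.
Qed.

(** Vertical projection of the field with constant coordinates [u] in [c]. It extends a single
    vertical vector to a local vertical field, as the Lie derivative condition requires. *)
Definition vfield c (u : 'rV[R]_n) x := of_chart c x u *m vproj x.

Lemma vfield_vertical c u x : vertical F x (vfield c u x).
Proof. by rewrite -(transverse_kernel hgT); have [] := vprojP x (of_chart c x u). Qed.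

Lemma vfield_smooth c u x : atlas c -> dom c x -> smooth_field_at (vfield c u) x.
Proof.
move=> ac cx d ad dx k.
(* [Ck_Jac] treats Jacobians that start from the chart in which [y] is read; the opposite one is
   obtained as a matrix inverse. *)
have CJ : Ckmx k (fwd d x) (fun y => Jac c d (bwd d y)).
  move=> i j; apply: (@Ck_near _ _ _ k (fun y => invmx (Jac d c (bwd d y)) i j)).
    apply: filterS (filterI (near_bwd dx (near_dom dx)) (near_bwd dx (near_dom cx))).
    move=> y [dy cy]; have JK := JacK ad ac dy cy.
    have [uJ _] := mulmx1_unit JK.
    by rewrite -[Jac c d _]mul1mx -(mulVmx uJ) -mulmxA JK mulmx1.
  apply: Ckmx_inv; last exact: Ck_Jac.
  rewrite fwdK //; by have [] := mulmx1_unit (JacK ad ac dx cx).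
have CV : Ckmx k (fwd d x) (fun y => u *m Jac c d (bwd d y) *m vproj_rep d y).
  apply: Ckmx_mul; last exact: vproj_smooth.
  by apply: Ckmx_mul => //; exact: Ckmx_cst.
apply: Ck_near ((Ckmx_row _ _ _).1 CV).
apply: filterS (filterI (near_bwd dx (near_dom dx)) (near_bwd dx (near_dom cx))).
move=> y [dy cy]; rewrite /vrep to_chartE // /vfield of_chartE // /vproj_rep /=.
set z := bwd d y in dy cy *; set a := chart_at z.
rewrite -(Jac_comp ac ad (atlas_chart_at z) cy dy (dom_chart_at z)) -/a.
by rewrite !mulmxA.
Qed.

Lemma vfield_at x v : vertical F x v -> vfield (chart_at x) v x = v.
Proof.
rewrite -(transverse_kernel hgT) => kv; rewrite /vfield of_chart_at.
by have [_ -> //] := vprojP x v.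
Qed.

End SmoothProjection.

(** * The bundle-like metric and the gradient of the temporal function *)

Section BundleLike.
Context (R : realType) (n q : nat) (M : manifold R n) (F : foliation M q).
Context (gT : M -> 'M[R]_n) (fut : M -> set 'rV[R]_n).
Context (hgT : transverse_lorentzian F gT).
Context (hfut : transverse_time_orientation F gT fut).
Context (f : M -> R).
Context (tf : transverse_temporal fut f).
Context (h : M -> 'M[R]_n).
Context (sh : smooth_tensor h).
Context (ph : forall x, posdef (h x)).

Implicit Types (x : M) (u v w : 'rV[R]_n).

Let P := vproj gT h.

Definition bundle_metric x : 'M[R]_n := gT x + P x *m h x *m (P x)^T.

Let g := bundle_metric.
Let ker := transverse_kernel hgT.
Let PP x := vprojP hgT ph x.

Lemma bundle_metricE x u v :
  bil (g x) u v = bil (gT x) u v + bil (h x) (u *m P x) (v *m P x).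
Proof. by rewrite /g /bundle_metric bil_addmx bil_mull. Qed.

Lemma vertical_fixed x v : vertical F x v -> v *m P x = v.
Proof. by rewrite -ker => kv; have [_ -> //] := PP x v. Qed.

Lemma vertical_image x v : vertical F x (v *m P x).
Proof. by rewrite -ker; have [] := PP x v. Qed.

Lemma vertical_ker x v w : vertical F x v -> bil (gT x) v w = 0.
Proof. by rewrite -ker; apply. Qed.

Lemma vertical_kerr x v w : vertical F x v -> bil (gT x) w v = 0.
Proof. by move=> vv; rewrite (bilC _ _ (transverse_sym hgT x)); exact: vertical_ker. Qed.

(** Pairing [v] under [g] with its own vertical part gives the [h]-square of that part, since [gT]
    kills vertical vectors and [P x] fixes them. *)
Lemma bundle_perp x v : vertical_perp F g x v <-> v *m P x = 0.
Proof.
split=> [pv|e w vw].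
  apply: (posdef_eq0 (ph x)); have vi := vertical_image x v.
  by have := pv _ vi; rewrite bundle_metricE (vertical_kerr _ vi) add0r (vertical_fixed vi).
by rewrite bundle_metricE e bil0l (vertical_kerr _ vw) addr0.
Qed.

Lemma horizontal_projection x v : (v - v *m P x) *m P x = 0.
Proof. by rewrite mulmxBl (vertical_fixed (vertical_image x v)) subrr. Qed.

Lemma vertical_fixed0 x v : vertical F x v -> v *m P x = 0 -> v = 0.
Proof. by move=> /vertical_fixed e; rewrite e. Qed.

Lemma bundle_sym x : (g x)^T = g x.
Proof.
rewrite /g /bundle_metric linearD /= !trmx_mul trmxK (transverse_sym hgT) mulmxA.
by have [-> _] := ph x.
Qed.

Lemma bundle_nondegenerate x v : bil_kernel (g x) v -> v = 0.
Proof.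
move=> kv; have e : v *m P x = 0 by apply/bundle_perp => w _; exact: kv.
apply: (vertical_fixed0 _ e); rewrite -ker => w.
by have := kv w; rewrite bundle_metricE e bil0l addr0.
Qed.

Lemma bundle_smooth : smooth_tensor g.
Proof.
apply/smooth_tensorP => c x ac cx k.
have sg := (smooth_tensorP gT).1 (transverse_smooth hgT) c x ac cx k.
have sH := (smooth_tensorP h).1 sh c x ac cx k.
have sP := vproj_smooth hgT sh ph k ac cx.
have S : Ckmx k (fwd c x) (fun y => trep c gT y +
   vproj_rep gT h c y *m trep c h y *m (vproj_rep gT h c y)^T).
  by apply: CkmxD => //; apply: Ckmx_mul; [exact: Ckmx_mul|exact: Ckmx_tr].
move=> i j; apply: Ck_near (S i j).
apply: filterS (near_bwd cx (near_dom cx)) => y dy.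
congr (fun A : 'M[R]_n => A i j).
rewrite /trep /vproj_rep /g /bundle_metric /=; set z := bwd c y in dy *.
set J := Jac c (chart_at z) z; set J' := Jac (chart_at z) c z.
have JJ : J' *m J = 1%:M.
  by apply: JacK; rewrite //; [exact: atlas_chart_at|exact: dom_chart_at].
rewrite /P; move: (vproj gT h z) => Q.
rewrite mulmxDr mulmxDl; congr (_ + _).
rewrite !trmx_mul -!mulmxA (mulmxA J' J) JJ mul1mx.
have JT : J^T *m J'^T = 1%:M by rewrite -trmx_mul JJ trmx1.
by rewrite (mulmxA J^T J'^T) JT mul1mx.
Qed.

(** The horizontal part of a [gT]-timelike vector is [g]-timelike, and on the kernel of [df] both
    summands of [g] are nonnegative. *)
Lemma bundle_index x : has_index (g x) 1.
Proof.
have [t qt] := index1_timelike (transverse_index hgT x).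
have [H1 _ _] := temporal_cone_form hgT hfut tf x.
apply: (has_index1 (D := dcol f x) (v := t - t *m P x)).
  rewrite bundle_metricE horizontal_projection bil0l addr0.
  have vi := vertical_image x t.
  rewrite bilDl bilNl (vertical_ker _ vi) oppr0 addr0 bilDr bilNr.
  by rewrite (vertical_kerr _ vi) oppr0 addr0.
move=> w dw; rewrite bundle_metricE addr_ge0 //; first exact: H1.
exact: posdef_ge0.
Qed.

Lemma bundle_lorentzian : lorentzian_metric g.
Proof.
split; first exact: bundle_smooth.
move=> x; split; [exact: bundle_sym| |exact: bundle_index].
apply/seteqP; split=> v; first exact: bundle_nondegenerate.
by move=> -> w; exact: bil0l.
Qed.

(** On horizontal fields [g] agrees with [gT]. In the vanishing Lie derivative of [gT] the brackets
    are vertical by projectability, so only the derivative of [g(X, Y)] along the vertical vector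
    remains. *)
Lemma bundle_basic (U : set M) (X Y : M -> 'rV[R]_n) : open U ->
  projectable F U X -> projectable F U Y ->
  (forall x, U x -> vertical_perp F g x (X x)) ->
  (forall x, U x -> vertical_perp F g x (Y x)) ->
  basic_on F U (fun x => bil (g x) (X x) (Y x)).
Proof.
move=> oU [sX pX] [sY pY] hX hY.
have sXx := (smooth_vfieldP X oU).1 sX; have sYx := (smooth_vfieldP Y oU).1 sY.
apply: flat_basic => //.
  move=> x Ux; apply: smooth_at_bil; first exact: bundle_smooth.
    exact: sXx.
  exact: sYx.
move=> x Ux v vv; set c := chart_at x.
have ac : atlas c by exact: atlas_chart_at.
(* The vertical extension of [v] is smooth on one chart domain, and projectability covers vertical
   fields on smaller open sets. *)
pose W := U `&` dom c.
have oW : open W by apply: openI => //; exact: dom_open.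
have Wx : W x by split=> //; exact: dom_chart_at.
have WU : W `<=` U by move=> z [].
pose V := vfield gT h c v.
have vV : vertical_vfield F W V.
  split; last by move=> y _; exact: vfield_vertical.
  apply/(smooth_vfieldP _ oW) => y [_ cy].
  exact: (vfield_smooth hgT sh ph).
have Vx : V x = v by exact: (vfield_at hgT ph).
have sW Z : (forall x, U x -> smooth_field_at Z x) -> smooth_vfield W Z.
  by move=> sZ; apply/(smooth_vfieldP _ oW) => y /WU; exact: sZ.
have [_ _ /(_ W V X Y oW vV (sW X sXx) (sW Y sYx) x Wx)] := hgT.
rewrite /lie_derivative Vx.
rewrite (vertical_ker _ (pX W V oW WU vV x Wx)).
rewrite (vertical_kerr _ (pY W V oW WU vV x Wx)) !subr0 => L.
apply: etrans L; apply: near_dfun.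
apply: filterS (open_nbhs_nbhs (conj oU Ux)) => y Uy.
by rewrite bundle_metricE ((bundle_perp y _).1 (hX y Uy)) bil0l addr0.
Qed.

Lemma bundle_metric_bundle_like : bundle_like F g.
Proof.
split; first exact: bundle_lorentzian.
- move=> x v; exists (v *m P x), (v - v *m P x).
  split; [exact: vertical_image| |by rewrite addrC subrK].
  by apply/bundle_perp; exact: horizontal_projection.
- by move=> x v [vv /bundle_perp pv]; exact: vertical_fixed0 vv pv.
- exact: bundle_basic.
Qed.

Lemma bundle_metric_associated : associated F g gT.
Proof.
move=> x v v' w w' [/bundle_perp pv vv] [/bundle_perp pw vw].
rewrite bundle_metricE pv bil0l addr0.
rewrite -[in RHS](subrK v' v) -[in RHS](subrK w' w) bilDl (vertical_ker _ vv) add0r.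
by rewrite bilDr (vertical_kerr _ vw) add0r.
Qed.

Lemma bundle_metric_temporal : temporal g fut f.
Proof.
split; first by case: tf.
move=> x; have sf := temporal_smooth tf (x := x); set D := dcol f x.
have [H1 H2 H3] := temporal_cone_form hgT hfut tf x.
have ug : g x \in unitmx.
  apply: unit_of_ker => v vg; apply: (@bundle_nondegenerate x).
  exact/bil_kerP.
pose v := D^T *m invmx (g x).
have gv w : bil (g x) v w = form D w.
  rewrite /bil /v -(mulmxA D^T) mulVmx // mulmx1 -trmx_mul mxE //.
have pv : v *m P x = 0.
  by apply/bundle_perp => w; rewrite gv -ker; exact: H3.
have tv w : bil (gT x) v w = form D w.
  by rewrite -gv bundle_metricE pv bil0l addr0.
have qv : bil (gT x) v v < 0.
  have [t qt] := index1_timelike (transverse_index hgT x).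
  have ct := timelike_causal qt.
  have dt : form D t != 0 by apply/eqP; exact: H2.
  rewrite ltNge; apply/negP => c0.
  (* With [a], [b], [s] as below, this vector of the kernel of [df] has [gT]-square
     [b ^+ 2 * s - b * a ^+ 2 >= 0], impossible for [b > 0] as [s < 0]; and [b = 0] would make [v] a
     causal zero of [df]. *)
  have du : form D (form D t *: v - form D v *: t) = 0.
    by rewrite formD formN !formZ mulrC subrr.
  have := H1 _ du; rewrite !(bilDl, bilDr, bilNl, bilNr, bilZl, bilZr).
  rewrite (bilC t v (transverse_sym hgT x)) !tv => hu.
  move: c0; rewrite tv; set a := form D t in dt hu; set b := form D v in hu * => b0.
  have a2 : 0 < a ^+ 2 by rewrite exprn_even_gt0.
  have [be|bn] := eqVneq b 0.
    apply: (H2 v) => //; split; last by rewrite tv -/b be.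
    by move=> /(_ t); rewrite tv -/a => /eqP; rewrite (negbTE dt).
  have b1 : 0 < b by rewrite lt0r bn.
  have h1 : 0 < b * a ^+ 2 by exact: mulr_gt0.
  have h2 : b ^+ 2 * bil (gT x) t t < 0 by rewrite pmulr_rlt0 // exprn_gt0.
  move: hu h1 h2; set s := bil (gT x) t t; rewrite !expr2; nra.
exists v; split.
- by move=> w; rewrite gv dfunE.
- by rewrite bundle_metricE pv bil0l addr0.
- rewrite (temporal_wedge hgT hfut tf); split.
    by apply/causalN/timelike_causal.
  by rewrite -/D formN -tv oppr_gt0.
Qed.

End BundleLike.

Theorem theorem6p2 (R : realType) (n q : nat) (M : manifold R n)
    (F : foliation M q) (gT : M -> 'M[R]_n) (fut : M -> set 'rV[R]_n)
    (hn : (3 <= n)%N) (hq : (2 <= q)%N) (hM : connected [set: M])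
    (hgT : transverse_lorentzian F gT)
    (hfut : transverse_time_orientation F gT fut) :
  let has_transverse_temporal := exists f : M -> R, transverse_temporal fut f in
  let has_basic_temporal := exists g : M -> 'M[R]_n,
    [/\ bundle_like F g, associated F g gT &
        exists f : M -> R, temporal g fut f /\ basic_on F setT f] in
  (has_transverse_temporal <-> has_basic_temporal) /\
  (has_transverse_temporal \/ has_basic_temporal ->
     transversely_stably_causal F gT fut).
Proof.
move=> has_transverse has_basic.
have TB : has_transverse -> has_basic.
  move=> [f tf]; have [h [sh ph]] := riemannian_metric M.
  exists (bundle_metric gT h); split.
  - exact: (bundle_metric_bundle_like hgT hfut tf sh ph).
  - by move=> x v v' w w' pv pw; exact: (bundle_metric_associated hgT ph).
  - exists f; split; first exact: (bundle_metric_temporal hgT hfut tf ph).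
    exact: (temporal_basic hgT hfut tf).
have BT : has_basic -> has_transverse.
  move=> [g [bg ag [f [tg bf]]]]; exists f.
  exact: (basic_temporal_transverse hgT hfut bg ag tg bf).
split; first by split.
by move=> [|/BT] [f tf]; exact: (temporal_stably_causal hgT hfut tf).
Qed.
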